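(* Let $f:\mathbb{R}^d\to\mathbb{R}$ be a quadratic function with (constant) Hessian matrix $\mathbf{A}$, and suppose $f$ is $\mu$-strongly convex ($\mu>0$) and has $L$-Lipschitz continuous gradient. Let $f^*=\min f$, let $\rho>0$, $\delta\ge 0$, and let $\{\mathbf{x}_k\}_{k\ge 0}$ be generated by the algorithm $\mathcal{RG}_\rho$ (see context) run with a $\delta$-approximated zeroth-order oracle of $f$ and step sizes $h_k=\frac{1}{12\,\mathrm{tr}(\mathbf{A})}$. Set $$C_1=\frac{5}{16}\mathrm{tr}(\mathbf{A})\,d+\frac{5}{384}\mathrm{tr}(\mathbf{A}),\qquad C_2=\frac{d}{3\,\mathrm{tr}(\mathbf{A})}+\frac{1}{72\,\mathrm{tr}(\mathbf{A})}.$$ Then for every $k\ge 0$, $$\mathbb{E} f(\mathbf{x}_{k+1})-f^*-\frac{24\,\mathrm{tr}(\mathbf{A})}{\mu}\Big(C_1\rho^2+C_2\frac{\delta^2}{\rho^2}\Big)\le\Big(1-\frac{\mu}{24\,\mathrm{tr}(\mathbf{A})}\Big)\Big(\mathbb{E} f(\mathbf{x}_k)-f^*-\frac{24\,\mathrm{tr}(\mathbf{A})}{\mu}\Big(C_1\rho^2+C_2\frac{\delta^2}{\rho^2}\Big)\Big),$$ where the expectation is over all the randomness in the algorithm.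
   Context: A $\delta$-approximated zeroth-order oracle of $f$ returns, for each queried point $\mathbf{x}\in\mathbb{R}^d$, a value $\tilde f(\mathbf{x})$ with $|\tilde f(\mathbf{x})-f(\mathbf{x})|\le\delta$; the error may be adversarial. Algorithm $\mathcal{RG}_\rho$: from a given starting point $\mathbf{x}_0\in\mathbb{R}^d$, at step $k$ draw a fresh standard Gaussian vector $\boldsymbol{\xi}_k\sim N(0,\mathbf{I}_d)$ independent of the past, query the oracle at $\mathbf{x}_k$ and $\mathbf{x}_k+\rho\boldsymbol{\xi}_k$, and set $$\mathbf{x}_{k+1}=\mathbf{x}_k-h_k\,\frac{\tilde f(\mathbf{x}_k+\rho\boldsymbol{\xi}_k)-\tilde f(\mathbf{x}_k)}{\rho}\,\boldsymbol{\xi}_k .$$ $f$ is $\mu$-strongly convex if $f(\mathbf{y})\ge f(\mathbf{x})+\langle\nabla f(\mathbf{x}),\mathbf{y}-\mathbf{x}\rangle+\frac{\mu}{2}\|\mathbf{x}-\mathbf{y}\|^2$ for all $\mathbf{x},\mathbf{y}$. *)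

(* Defs.v *)
(* MathComp-Analysis *)
From HB Require Import structures.
From mathcomp Require Import all_boot all_order all_algebra.
From mathcomp Require Import all_classical all_reals all_analysis.

Set Implicit Arguments.
Unset Strict Implicit.
Unset Printing Implicit Defensive.

Import Order.TTheory GRing.Theory Num.Theory.
Import numFieldNormedType.Exports.

Local Open Scope classical_set_scope.
Local Open Scope ring_scope.

Section euclidean_space.
Context {R : realType} {d : nat}.
Implicit Types (u v x y : 'cV[R]_d) (f : 'cV[R]_d -> R).

Definition dot u v : R := \sum_(i < d) u i ord0 * v i ord0.

(* The library norm `|u| on matrices is the sup norm. *)
Definition enorm u : R := Num.sqrt (dot u u).

Definition basis_vec (i : 'I_d) : 'cV[R]_d := delta_mx i ord0.

Definition grad f x : 'cV[R]_d := \col_i 'D_(basis_vec i) f x.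

Definition hessian f x : 'M[R]_d :=
  \matrix_(i, j) 'D_(basis_vec i) (fun y => 'D_(basis_vec j) f y) x.

Definition quadratic f : Prop :=
  exists (Q : 'M[R]_d) (b : 'cV[R]_d) (c : R),
    forall x, f x = dot x (Q *m x) + dot b x + c.

Definition strongly_convex (mu : R) f : Prop :=
  forall x y,
    f y >= f x + dot (grad f x) (y - x) + mu / 2 * enorm (x - y) ^+ 2.

Definition lipschitz_gradient (L : R) f : Prop :=
  forall x y, enorm (grad f x - grad f y) <= L * enorm (x - y).

Definition is_minimum f (m : R) : Prop :=
  (exists x, f x = m) /\ (forall x, m <= f x).

Definition approx_oracle (delta : R) f (g : 'cV[R]_d -> R) : Prop :=
  forall x, `|g x - f x| <= delta.

End euclidean_space.

Section random_vectors.
Context {disp : measure_display} {T : measurableType disp} {R : realType}.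
Variable P : probability T R.

Definition measurable_vec (d : nat) (X : T -> 'cV[R]_d) : Prop :=
  forall i, measurable_fun [set: T] (fun w => X w i ord0).

(* The law of X on measurable rectangles is that of the d-fold product of
   N(0, 1), i.e. X has law N(0, I_d). The second argument of normal_prob is the
   standard deviation. *)
Definition std_gaussian (d : nat) (X : T -> 'cV[R]_d) : Prop :=
  measurable_vec X /\
  forall U : 'I_d -> set R, (forall i, measurable (U i)) ->
    P [set w | forall i, U i (X w i ord0)] =
    (\prod_(i < d) normal_prob 0 1 (U i))%E.

Definition events_of (X : T -> R) : set (set T) :=
  preimage_set_system [set: T] X measurable.

Definition events_of_vec (d : nat) (X : T -> 'cV[R]_d) : set (set T) :=
  \bigcup_i events_of (fun w => X w i ord0).

Definition independent_systems (F G : set (set T)) : Prop :=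
  forall A B, F A -> G B -> P (A `&` B) = (P A * P B)%E.

End random_vectors.

Section random_gradient_method.
Context {disp : measure_display} {T : measurableType disp} {R : realType}.
Context {d : nat}.
Variables (h : nat -> R) (rho : R) (x0 : 'cV[R]_d).
(* fo k w is the (possibly random, time- and history-dependent) function
   answering the two oracle queries of step k in the outcome w. *)
Variables (fo : nat -> T -> 'cV[R]_d -> R) (xi : nat -> T -> 'cV[R]_d).

Fixpoint RG (k : nat) (w : T) : 'cV[R]_d :=
  if k is k'.+1 then
    let x := RG k' w in
    x - (h k' * ((fo k' w (x + rho *: xi k' w) - fo k' w x) / rho)) *: xi k' w
  else x0.

Definition RG_answer (k : nat) (w : T) : R := fo k w (RG k w).

Definition RG_answer_shift (k : nat) (w : T) : R :=
  fo k w (RG k w + rho *: xi k w).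

(* The sigma-algebra generated by the directions drawn and the oracle answers
   received before step k; RG k is a function of these. *)
Definition RG_past (k : nat) : set (set T) :=
  <<s \bigcup_(j in `I_k)
        (events_of_vec (xi j) `|` events_of (RG_answer j)
           `|` events_of (RG_answer_shift j)) >>.

(* At each step the direction is N(0, I_d) and independent of the past. As the
   oracle is adversarial, its answers may depend on the past, on the current
   direction, and on randomness of its own; they are only required to be
   random variables, without which expectations would be meaningless. *)
Definition RG_randomness (P : probability T R) : Prop :=
  [/\ forall k, std_gaussian P (xi k),
      forall k, independent_systems P (RG_past k) <<s events_of_vec (xi k) >>,
      forall k, measurable_fun [set: T] (RG_answer k)
    & forall k, measurable_fun [set: T] (RG_answer_shift k)].

End random_gradient_method.

(* Main.v *)
(* Write T = tr A, h = 1 / (12 T), s = <grad f(x), xi>, q = xi^T A xi. The finite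
   difference is s + r with r = rho q / 2 + e / rho, where |e| <= 2 delta is the
   oracle error, and since f is quadratic,
     f(x+) = f(x) - h (s + r) s + h^2 (s + r)^2 q / 2.
   Young's inequality removes the adversarial term r pointwise:
     f(x+) + (h / 2) s^2 <= f(x) + h^2 s^2 q + (terms in q, q^2, q^3 only).
   Every remaining term is nonnegative, so no integrability is needed to average
   it over xi with x frozen, by Tonelli and independence. The Gaussian moments
   are E s^2 = |grad f(x)|^2, E (s^2 q) <= 3 T |grad f(x)|^2, E q = T,
   E q^2 <= 3 T^2, E q^3 <= 15 T^3; the last three come from writing A as a
   nonnegative combination of b b^T with |b| = 1 and from Jensen's inequality.
   With |grad f|^2 >= 2 mu (f - f^* ) this is the claimed contraction. *)

Require Import Defs.
From HB Require Import structures.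
From mathcomp Require Import all_boot all_order all_algebra.
From mathcomp Require Import all_classical all_reals all_analysis.
From mathcomp Require Import measurable_realfun ring lra.

Set Implicit Arguments.
Unset Strict Implicit.
Unset Printing Implicit Defensive.

Import Order.TTheory GRing.Theory Num.Theory.
Import numFieldNormedType.Exports.

Local Open Scope classical_set_scope.
Local Open Scope ring_scope.

(** * Independence *)

Section independence.
Context {disp : measure_display} {T : measurableType disp} {R : realType}.
Variable P : probability T R.
Implicit Types F G : set (set T).

Lemma sigma_sub_measurable G : G `<=` measurable -> <<s G >> `<=` measurable.
Proof. by move=> mG; apply: smallest_sub mG; exact: sigma_algebra_measurable. Qed.

(** Dynkin's argument: for fixed [B], restricting [P] to [B] and scaling [P] by [P B] give two
    finite measures that agree on the pi-system [F], hence on the sigma-algebra it generates. *)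
Lemma independent_sigmal F G :
  F `<=` measurable -> G `<=` measurable -> setI_closed F -> F setT ->
  independent_systems P F G -> independent_systems P <<s F >> G.
Proof.
move=> mF mG FI FT FG A B sA GB.
have mB := mG _ GB.
have PB : (0 <= fine (P B))%R by exact: fine_ge0.
pose m1 := mrestr P mB.
pose m2 := mscale (NngNum PB) P.
have -> : (P A * P B)%E = m2 A.
  by rewrite /m2 /mscale/= muleC fineK// fin_num_measure.
rewrite -[LHS]/(m1 A).
apply: (g_sigma_algebra_measure_unique F mF (fun=> setT)) => //.
- by rewrite bigcup_const.
- move=> C FC; rewrite -[LHS]/(P (C `&` B)) FG//= /m2 /mscale/= muleC fineK//.
  by rewrite fin_num_measure.
- by move=> _; rewrite -ge0_fin_numE ?fin_num_measure.
Qed.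

(* Independence says that [(X, Y)] has the product of the two marginal laws. *)
Lemma independent_tonelli d1 d2 (T1 : measurableType d1)
    (T2 : measurableType d2) (X : T -> T1) (Y : T -> T2)
    (Phi : T1 * T2 -> \bar R) :
  measurable_fun setT X -> measurable_fun setT Y ->
  (forall A B, measurable A -> measurable B ->
    P (X @^-1` A `&` Y @^-1` B) = P (X @^-1` A) * P (Y @^-1` B))%E ->
  measurable_fun setT Phi -> (forall x, 0 <= Phi x)%E ->
  (\int[P]_w Phi (X w, Y w) = \int[P]_w1 \int[P]_w2 Phi (X w1, Y w2))%E.
Proof.
move=> mX mY indXY mPhi Phi0.
have mXY := measurable_fun_pair mX mY.
pose X' : {mfun T >-> T1} := HB.pack X (isMeasurableFun.Build _ _ _ _ _ mX).
pose Y' : {mfun T >-> T2} := HB.pack Y (isMeasurableFun.Build _ _ _ _ _ mY).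
pose XY' : {mfun T >-> (T1 * T2)%type} :=
  HB.pack (fun w : T => (X w, Y w)) (isMeasurableFun.Build _ _ _ _ _ mXY).
transitivity (\int[distribution P X' \x distribution P Y']_x Phi x)%E.
  rewrite (eq_measure_integral (distribution P XY')); last first.
    move=> A mA _; apply: product_measure_unique; last exact: mA.
    exact: indXY.
  by rewrite ge0_integral_distribution.
rewrite fubini_tonelli1// /fubini_F.
rewrite (ge0_integral_distribution X') /=; last 2 first.
- exact: measurable_fun_fubini_tonelli_F.
- by move=> x; apply: integral_ge0.
apply: eq_integral => w _ /=.
rewrite (ge0_integral_distribution Y')//.
exact/measurableT_comp.
Qed.

(** Passing to the law of [Y] turns the inner integral into a Fubini section integral composed with
    [X]. *)
Lemma measurable_partial_integral d1 d2 (T1 : measurableType d1)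
    (T2 : measurableType d2) (X : T -> T1) (Y : T -> T2)
    (Phi : T1 * T2 -> \bar R) :
  measurable_fun setT X -> measurable_fun setT Y ->
  measurable_fun setT Phi -> (forall x, 0 <= Phi x)%E ->
  measurable_fun setT (fun w => \int[P]_w' Phi (X w, Y w'))%E.
Proof.
move=> mX mY mPhi Phi0.
pose Y' : {mfun T >-> T2} := HB.pack Y (isMeasurableFun.Build _ _ _ _ _ mY).
rewrite (_ : (fun w => _) = fubini_F (distribution P Y') Phi \o X).
  by apply: measurableT_comp mX; exact: measurable_fun_fubini_tonelli_F.
apply/funext => w; rewrite /fubini_F/= (ge0_integral_distribution Y')//.
exact/measurableT_comp.
Qed.

End independence.

(** * Moments of the normal distribution *)

Section normal_moments.
Context {R : realType}.
Notation mu := (@lebesgue_measure R).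

(** The Radon-Nikodym derivative is determined only up to null sets; it agrees almost everywhere
    with [normal_pdf] because both integrate to [normal_prob] over every measurable set. *)
Lemma ge0_integral_normal_prob (f : R -> \bar R) :
  measurable_fun setT f -> (forall x, 0 <= f x)%E ->
  (\int[normal_prob 0 1]_x f x = \int[mu]_x (f x * (normal_pdf 0 1 x)%:E))%E.
Proof.
move=> mf f0.
have dom := @normal_prob_dominates R 0 1.
rewrite -(Radon_Nikodym_SigmaFinite.change_of_variables dom)//.
have mphi : measurable_fun setT (fun x : R => (normal_pdf 0 1 x)%:E).
  by apply/measurable_EFinP; exact: measurable_normal_pdf.
apply: ae_eq_integral => //.
- apply: emeasurable_funM => //.
  exact: measurable_int (Radon_Nikodym_SigmaFinite.f_integrable dom).
- exact: emeasurable_funM.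
- apply: ae_eqe_mul2l.
  apply: integral_ae_eq => //.
  + exact: Radon_Nikodym_SigmaFinite.f_integrable.
  + by move=> A _ mA; rewrite -Radon_Nikodym_SigmaFinite.f_integral.
Qed.

Definition std_pdf (x : R) : R := normal_peak 1 * expR (- (x ^+ 2 / 2)).

Lemma normal_pdf01E x : normal_pdf 0 1 x = std_pdf x.
Proof.
rewrite normal_pdfE ?oner_eq0// /std_pdf /normal_fun subr0 expr1n.
by rewrite mulNr.
Qed.

Lemma std_pdf_ge0 x : 0 <= std_pdf x.
Proof. by rewrite mulr_ge0 ?normal_peak_ge0 ?expR_ge0. Qed.

Lemma std_pdfN x : std_pdf (- x) = std_pdf x.
Proof. by rewrite /std_pdf sqrrN. Qed.

Lemma is_derive_std_pdf x : is_derive x (1 : R) std_pdf (- x * std_pdf x).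
Proof.
pose w : {poly R} := - 2^-1 *: 'X^2.
have wE y : w.[y] = - (y ^+ 2 / 2).
  by rewrite hornerZ hornerXn; field.
have -> : std_pdf = normal_peak 1 \*: (expR \o horner w).
  by apply/funext => y /=; rewrite /std_pdf -wE.
apply: is_derive_eq.
rewrite /= /GRing.scale/= derivZ derivXn !hornerE/= /std_pdf; field.
by [].
Qed.

Lemma continuous_std_pdf : continuous std_pdf.
Proof.
move=> x; apply/differentiable_continuous/derivable1_diffP.
by have [] := is_derive_std_pdf x.
Qed.

(** One Taylor term suffices: [expR y >= y ^+ k.+1 / k.+1!] at [y = x ^+ 2 / 2] bounds the product
    by [C * x ^- (k + 2)], which is at most [C / x] since [x >= 1]. *)
Lemma cvg_exprn_std_pdf k : n.+1%:R ^+ k * std_pdf n.+1%:R @[n --> \oo] --> 0.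
Proof.
pose C : R := normal_peak 1 * k.+1`!%:R * 2 ^+ k.+1.
have C0 : 0 <= C by rewrite !mulr_ge0 ?normal_peak_ge0 ?exprn_ge0.
apply: (@squeeze_cvgr _ _ _ _ (fun=> 0) (fun n => C * n.+1%:R^-1)).
- apply: nearW => n; rewrite mulr_ge0 ?std_pdf_ge0 ?exprn_ge0//=.
  set x : R := n.+1%:R; have x1 : 1 <= x by rewrite ler1n.
  have x0 : 0 < x by exact: lt_le_trans x1.
  rewrite /std_pdf expRN.
  have /(expR_ge1Dxn k) : 0 <= x ^+ 2 / 2 by rewrite divr_ge0 ?exprn_ge0// ltW.
  set y := _ ^+ _ / _ => ey.
  have y0 : 0 < y by rewrite !(divr_gt0, exprn_gt0)// ltr0n fact_gt0.
  have {}ey : (expR (x ^+ 2 / 2))^-1 <= y^-1.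
    by rewrite lef_pV2 ?posrE ?expR_gt0//; apply: le_trans ey; rewrite lerDr.
  apply: (@le_trans _ _ (x ^+ k * (normal_peak 1 * y^-1))).
    by rewrite !ler_wpM2l ?normal_peak_ge0 ?exprn_ge0 ?(ltW x0).
  have -> : x ^+ k * (normal_peak 1 * y^-1) = C * x^-1 * (x ^+ k.+1)^-1.
    rewrite /y /C exprMn exprVn (exprAC x) !exprS !mulr1.
    have := lt0r_neq0 x0; have : x ^+ k != 0 by rewrite expf_neq0// lt0r_neq0.
    have : k.+1`!%:R != 0 :> R by rewrite pnatr_eq0 -lt0n fact_gt0.
    have : 2 ^+ k != 0 :> R by rewrite expf_neq0.
    move: (x ^+ k) (k.+1`!%:R) (2 ^+ k : R) => a b c c0 b0 a0 xn0.
    by clearbody x; field; rewrite c0 b0 a0 xn0.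
  by rewrite ler_piMr ?mulr_ge0 ?invr_ge0 ?(ltW x0)// invf_le1 ?exprn_gt0// exprn_ege1.
- exact: cvg_cst.
- rewrite -[X in _ --> X](mulr0 C); apply: cvgM; first exact: cvg_cst.
  exact: cvg_harmonic.
Qed.

Lemma cvg_horner_std_pdf (p : {poly R}) :
  p.[n.+1%:R] * std_pdf n.+1%:R @[n --> \oo] --> 0.
Proof.
(* The extra monomial absorbs the factor ['X] when [p] is replaced by [p * 'X + c] in the
   induction. *)
suff H : forall k, p.[n.+1%:R] * (n.+1%:R ^+ k * std_pdf n.+1%:R) @[n --> \oo] --> 0.
  have := H 0; under eq_fun do rewrite expr0 mul1r.
  exact.
elim/poly_ind: p => [|p c IH] k.
  by under eq_fun do rewrite horner0 mul0r; exact: cvg_cst.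
have -> : (fun n => (p * 'X + c%:P).[n.+1%:R] *
    (n.+1%:R ^+ k * std_pdf n.+1%:R)) =
  (fun n => p.[n.+1%:R] * (n.+1%:R ^+ k.+1 * std_pdf n.+1%:R) +
    c * (n.+1%:R ^+ k * std_pdf n.+1%:R)).
  by apply/funext => n; rewrite hornerMXaddC exprS; ring.
rewrite -[X in _ --> X](addr0 0) -[X in _ --> 0 + X](mulr0 c).
apply: cvgD; first exact: IH.
by apply: cvgM; [exact: cvg_cst|exact: cvg_exprn_std_pdf].
Qed.

(** Since the density has derivative [- x * std_pdf x], an antiderivative is [- p * std_pdf];
    evenness of the density lets both endpoint terms be written with [std_pdf n.+1]. *)
Lemma integral_horner_std_pdf (p : {poly R}) (n : nat) :
  (\int[mu]_(x in `[(- n.+1%:R)%R, n.+1%:R%R])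
    ((x * p.[x] - p^`().[x]) * std_pdf x)%:E
   = (p.[- n.+1%:R] * std_pdf n.+1%:R - p.[n.+1%:R] * std_pdf n.+1%:R)%:E)%E.
Proof.
have dF x : is_derive x (1 : R) (fun x => - p.[x] * std_pdf x)
    ((x * p.[x] - p^`().[x]) * std_pdf x).
  have -> : (fun x => - p.[x] * std_pdf x) = horner (- p) * std_pdf.
    by apply/funext => y; rewrite -hornerN.
  have ? := is_derive_std_pdf x.
  apply: is_derive_eq; rewrite /GRing.scale/= derivN !hornerN. ring.
have cF : continuous (fun x => - p.[x] * std_pdf x).
  move=> x; apply/differentiable_continuous/derivable1_diffP.
  by have [] := dF x.
rewrite (continuous_FTC2 (F := fun x => - p.[x] * std_pdf x)).
- by rewrite -EFinB std_pdfN; congr EFin; ring.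
- by rewrite ltrNl; apply: lt_trans (ltr0Sn _ _); rewrite oppr_lt0.
- apply: continuous_subspaceT => x; apply: cvgM; last exact: continuous_std_pdf.
  apply: cvgB; last exact: continuous_horner.
  by apply: cvgM; [exact: cvg_id|exact: continuous_horner].
- split.
  + by move=> x _; have [] := dF x.
  + exact/cvg_at_right_filter/cF.
  + exact/cvg_at_left_filter/cF.
- by move=> x _; rewrite derive1E; have [] := dF x.
Qed.

(* [x * p x - p' x] integrates to [0] against the Gaussian density: it is the
   derivative of [- p] times the density. *)
Lemma integral_normal_prob_horner (q : R -> R) (p : {poly R}) (c : R) :
  (forall x, 0 <= q x) -> (forall x, q x = c + (x * p.[x] - p^`().[x])) ->
  (\int[normal_prob 0 1]_x (q x)%:E = c%:E)%E.
Proof.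
move=> q0 qE.
have cq : continuous q.
  have -> : q = horner (c%:P + ('X * p - p^`())).
    by apply/funext => x; rewrite qE !hornerE.
  exact: continuous_horner.
have mq : measurable_fun setT q by exact: continuous_measurable_fun.
rewrite ge0_integral_normal_prob//; last exact/measurable_EFinP.
under eq_integral do rewrite normal_pdf01E -EFinM.
pose I n := `[- n.+1%:R, n.+1%:R : R]%classic.
have UI : \bigcup_n I n = setT.
  apply/seteqP; split => // x _.
  exists (Num.truncn `|x|) => //; rewrite /I/= in_itv/= -ler_norml.
  by rewrite ltW// truncnS_gt.
have cvgI (f : R -> R) : measurable_fun setT f -> (forall x, 0 <= f x) ->
    (\int[mu]_(x in I n) (f x)%:E @[n --> \oo] --> \int[mu]_x (f x)%:E)%E.
  move=> mf f0; rewrite -UI; apply: ge0_nondecreasing_set_cvg_integral => //.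
  - apply/nondecreasing_seqP => n; rewrite subsetEset => x.
    rewrite /I/= !in_itv/= -!ler_norml => /le_trans; apply.
    by rewrite ler_nat.
  - by move=> n; exact: measurable_itv.
  - by move=> n; exact/measurable_funTS/measurable_EFinP.
  - by move=> n x _; rewrite lee_fin.
have mpdf : measurable_fun setT std_pdf.
  by apply: continuous_measurable_fun; exact: continuous_std_pdf.
have int1 : (\int[mu]_x (std_pdf x)%:E = 1)%E.
  rewrite -(integral_normal_pdf (0 : R) 1).
  by apply: eq_integral => x _; rewrite normal_pdf01E.
have integI n (g : R -> R) : continuous g -> mu.-integrable (I n) (EFin \o g).
  move=> cg; apply: continuous_compact_integrable; first exact: segment_compact.
  exact/continuous_subspaceT.
(* On a compact interval the signed part is integrable and contributes only endpoint terms, which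
   vanish in the limit. Monotone convergence is applied only to the nonnegative integrands
   [q * std_pdf] and [std_pdf]. *)
have IE n : (\int[mu]_(x in I n) (q x * std_pdf x)%:E =
    c%:E * \int[mu]_(x in I n) (std_pdf x)%:E +
    (p.[- n.+1%:R] * std_pdf n.+1%:R - p.[n.+1%:R] * std_pdf n.+1%:R)%:E)%E.
  have cG : continuous (fun x : R => (x * p.[x] - p^`().[x]) * std_pdf x).
    move=> x; apply: cvgM; last exact: continuous_std_pdf.
    apply: cvgB; last exact: continuous_horner.
    by apply: cvgM; [exact: cvg_id|exact: continuous_horner].
  have ipdf := integI n _ continuous_std_pdf.
  rewrite -integral_horner_std_pdf -integralZl//; last exact: measurable_itv.
  under [in LHS]eq_integral do rewrite qE mulrDl EFinD EFinM.
  rewrite integralD//.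
  - exact: measurable_itv.
  - by apply: integrableZl => //; exact: measurable_itv.
  - exact: integI cG.
have := cvgI (fun x => q x * std_pdf x).
rewrite (eq_cvg _ _ IE) => lim1.
apply/esym; apply: (cvg_unique _ _ (lim1 _ _)) => //=; last 2 first.
- exact: measurable_funM.
- by move=> x; rewrite mulr_ge0 ?std_pdf_ge0.
rewrite -[X in _ --> X]adde0; apply: cvgeD => //.
  by rewrite -[X in _ --> X]mule1 -int1; apply: cvgeZl => //; apply: cvgI => //; exact: std_pdf_ge0.
apply: cvg_EFin; first exact: nearW.
rewrite -[X in _ --> X](subr0 0); apply: cvgB; last exact: cvg_horner_std_pdf.
(* The left endpoint becomes a right endpoint for the reflected polynomial. *)
have := cvg_horner_std_pdf (p \Po (- 'X)).
by under eq_fun do rewrite horner_comp hornerN hornerX; apply.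
Qed.

End normal_moments.

(** * Gaussian vectors *)

Section gaussian_vector.
Context {disp : measure_display} {T : measurableType disp} {R : realType}.
Variable P : probability T R.

Let polyE := (derivD, derivZ, derivXn, derivX, derivC, hornerD, hornerZ,
  hornerMn, hornerXn, hornerX, hornerC, horner0, scaler0).

(** For j = 1, ..., 6, the monomial [x ^+ j] minus its Gaussian moment equals [x * p - p'] with p =
    1, X, X^2 + 2, X^3 + 3X, X^4 + 4X^2 + 8, X^5 + 5X^3 + 15X respectively. The witness here and in
    the next two lemmas combines these with the coefficients of the binomial expansion. *)
Lemma integral_normal_prob_affine2 (y a : R) :
  (\int[normal_prob 0 1]_x ((y + a * x) ^+ 2)%:E = (y ^+ 2 + a ^+ 2)%:E)%E.
Proof.
apply: (@integral_normal_prob_horner _ _ ((2 * y * a)%:P + a ^+ 2 *: 'X)).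
  by move=> x; rewrite sqr_ge0.
by move=> x; rewrite !polyE; ring.
Qed.

Lemma integral_normal_prob_affine4 (y a : R) :
  (\int[normal_prob 0 1]_x ((y + a * x) ^+ 4)%:E =
   (y ^+ 4 + 6 * a ^+ 2 * y ^+ 2 + 3 * a ^+ 4)%:E)%E.
Proof.
apply: (@integral_normal_prob_horner _ _
  ((4 * y ^+ 3 * a)%:P + (6 * y ^+ 2 * a ^+ 2) *: 'X
   + (4 * y * a ^+ 3) *: ('X^2 + 2%:P) + a ^+ 4 *: ('X^3 + 3 *: 'X))).
  by move=> x; rewrite exprn_even_ge0.
by move=> x; rewrite !polyE; ring.
Qed.

Lemma integral_normal_prob_affine6 (y a : R) :
  (\int[normal_prob 0 1]_x ((y + a * x) ^+ 6)%:E =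
   (y ^+ 6 + 15 * a ^+ 2 * y ^+ 4 + 45 * a ^+ 4 * y ^+ 2 + 15 * a ^+ 6)%:E)%E.
Proof.
apply: (@integral_normal_prob_horner _ _
  ((6 * y ^+ 5 * a)%:P + (15 * y ^+ 4 * a ^+ 2) *: 'X
   + (20 * y ^+ 3 * a ^+ 3) *: ('X^2 + 2%:P)
   + (15 * y ^+ 2 * a ^+ 4) *: ('X^3 + 3 *: 'X)
   + (6 * y * a ^+ 5) *: ('X^4 + 4 *: 'X^2 + 8%:P)
   + a ^+ 6 *: ('X^5 + 5 *: 'X^3 + 15 *: 'X))).
  by move=> x; rewrite exprn_even_ge0.
by move=> x; rewrite !polyE; ring.
Qed.

Variables (d : nat) (X : T -> 'cV[R]_d).
Hypothesis gX : std_gaussian P X.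

(** Cylinders that constrain only the coordinates below [m]: a pi-system generating the
    sigma-algebra of those coordinates. *)
Let rect (m : nat) : set (set T) :=
  [set A | exists2 U : 'I_d -> set R,
    (forall i, measurable (U i)) /\ (forall i : 'I_d, (m <= i)%N -> U i = setT) &
    A = [set w | forall i, U i (X w i ord0)]].

Let measurable_rect m : rect m `<=` measurable.
Proof.
move=> _ [U [mU _] ->].
rewrite (_ : [set w | _] = \bigcap_(i in [set: 'I_d]) ((fun w => X w i ord0) @^-1` U i)).
  apply: fin_bigcap_measurable => // i _.
  by rewrite -[_ @^-1` _]setTI; apply: gX.1.
by apply/seteqP; split => w /= H i; [move=> _; exact: H|exact: H].
Qed.

Let setI_closed_rect m : setI_closed (rect m).
Proof.
move=> _ _ [U [mU UT] ->] [V [mV VT] ->].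
exists (fun i => U i `&` V i); first split => i.
- exact: measurableI.
- by move=> mi; rewrite UT// VT// setTI.
- by apply/seteqP; split => w /=; [move=> [HU HV] i; split|
    move=> H; split=> i; have [] := H i].
Qed.

Let rectT m : rect m setT.
Proof. by exists (fun=> setT) => //; apply/seteqP; split. Qed.

Lemma std_gaussian_coord i (B : set R) : measurable B ->
  P ((fun w => X w i ord0) @^-1` B) = normal_prob 0 1 B.
Proof.
move=> mB; have := gX.2 (fun j => if j == i then B else setT).
rewrite (bigD1 i)//= eqxx big1 ?mule1 => [<-|j /negbTE ->]; last first.
- exact: (probability_setT (normal_prob 0 1)).
- by move=> j; case: ifP.
congr (P _); apply/seteqP; split => w /=.
  by move=> Bw j; case: eqP => [->|].
by move=> /(_ i); rewrite eqxx.
Qed.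

(** Side [m] of such a cylinder is the whole line, so intersecting with an event of coordinate [m]
    merely fills in that side, and the product formula splits off one factor. *)
Let independent_rect (m : 'I_d) :
  independent_systems P (rect m) (events_of (fun w => X w m ord0)).
Proof.
move=> _ _ [U [mU UT] ->] [B mB <-]; rewrite setTI std_gaussian_coord// gX.2//.
have -> : [set w | forall i, U i (X w i ord0)] `&`
    (fun w => X w m ord0) @^-1` B =
  [set w | forall i, (if i == m then B else U i) (X w i ord0)].
  apply/seteqP; split => w /=.
    by move=> [HU HB] i; case: eqP => [->|].
  move=> H; split=> [i|]; last by have := H m; rewrite eqxx.
  by have := H i; case: eqP => [->|//]; rewrite UT.
rewrite (gX.2 (fun i => if i == m then B else U i)); last first.
  by move=> i; case: ifP.
rewrite (bigD1 m)//= eqxx [in RHS](bigD1 m)//= UT//.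
rewrite (probability_setT (normal_prob 0 1)) mul1e muleC; congr (_ * _)%E.
by apply: eq_bigr => i /negbTE ->.
Qed.

(** Partial sums of [dot v (X w)]: each new Gaussian coordinate is independent of the sum built so
    far. *)
Let Z (v : 'cV[R]_d) (m : nat) (w : T) : R :=
  \sum_(i < d) (if (i < m)%N then v i ord0 * X w i ord0 else 0).

Let measurable_Z v m :
  measurable_fun (setT : set (g_sigma_algebraType (rect m))) (Z v m).
Proof.
apply: measurable_sum => i; have [im|im] := ltnP i m; last exact: measurable_cst.
apply: measurable_funM; first exact: measurable_cst.
move=> _ U mU; rewrite setTI; apply: sub_sigma_algebra.
exists (fun j => if j == i then U else setT).
- split=> j; first by case: ifP.
  by case: eqP => // ->; rewrite leqNgt im.
- apply/seteqP; split => w /=.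
    by move=> Bw j; case: eqP => [->|].
  by move=> /(_ i); rewrite eqxx.
Qed.

Let measurable_ZT v m : measurable_fun (setT : set T) (Z v m).
Proof.
move=> _ U mU; apply: (sigma_sub_measurable (@measurable_rect m)).
exact: measurable_Z.
Qed.

Let independent_Z v (m : 'I_d) (A B : set R) : measurable A -> measurable B ->
  (P (Z v m @^-1` A `&` (fun w => X w m ord0) @^-1` B) =
   P (Z v m @^-1` A) * P ((fun w => X w m ord0) @^-1` B))%E.
Proof.
move=> mA mB.
apply: (independent_sigmal (@measurable_rect m) _ (@setI_closed_rect m)
  (@rectT m) (@independent_rect m)).
- by move=> _ [C mC <-]; exact: gX.1.
- by rewrite -[_ @^-1` _]setTI; exact: measurable_Z.
- by exists B => //; rewrite setTI.
Qed.

(** An even power is nonnegative, so Tonelli integrates out the newest coordinate with the earlier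
    partial sum frozen. *)
Let integral_step v (m : 'I_d) (n : nat) : ~~ odd n ->
  (\int[P]_w ((Z v m.+1 w) ^+ n)%:E =
   \int[P]_w \int[normal_prob 0 1]_x ((Z v m w + v m ord0 * x) ^+ n)%:E)%E.
Proof.
move=> en.
have ZS w : Z v m.+1 w = Z v m w + v m ord0 * X w m ord0.
  rewrite /Z (bigD1 m)//= ltnSn [in RHS](bigD1 m)//= ltnn add0r addrC.
  congr (_ + _); apply: eq_bigr => i im.
  by rewrite ltnS leq_eqVlt -val_eqE/= in im *; rewrite (negbTE im).
pose Phi (zx : R * R) : \bar R := ((zx.1 + v m ord0 * zx.2) ^+ n)%:E.
have mPhi : measurable_fun setT Phi.
  apply/measurable_EFinP; apply: measurable_funX.
  apply: measurable_funD => //.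
  by apply: measurable_funM => //; exact: measurable_cst.
have Phi0 zx : (0 <= Phi zx)%E by rewrite lee_fin exprn_even_ge0.
have mX := gX.1 m.
under eq_integral do rewrite ZS.
rewrite (independent_tonelli (Phi := Phi) (measurable_ZT v m) mX)//; last first.
  exact: independent_Z.
apply: eq_integral => w _.
have mX' : measurable_fun setT (fun w => X w m ord0 : measurableTypeR R).
  exact: mX.
pose X' : {mfun T >-> measurableTypeR R} :=
  HB.pack (fun w => X w m ord0) (isMeasurableFun.Build _ _ _ _ _ mX').
transitivity (\int[distribution P X']_x ((Z v m w + v m ord0 * x) ^+ n)%:E)%E.
  rewrite ge0_integral_distribution//=; last by move=> x; exact: (Phi0 (_, x)).
  apply/measurable_EFinP. apply: measurable_funX.
  by apply: measurable_funD => //; exact: measurable_funM.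
by apply: eq_measure_integral => B mB _; exact: std_gaussian_coord.
Qed.

Let sq (v : 'cV[R]_d) (m : nat) : R := \sum_(i < d) (if (i < m)%N then v i ord0 ^+ 2 else 0).

Let ge0_even (r : R) n : ~~ odd n -> (0 <= (r ^+ n)%:E)%E.
Proof. by move=> en; rewrite lee_fin exprn_even_ge0. Qed.

(** The three moments go through one induction because adding a coordinate expresses each even
    moment through the lower even ones. The constants 1, 3, 15 are the double factorials in the even
    moments of a centred Gaussian of variance [sq v m]. *)
Let moments_step v m : (m <= d)%N ->
  [/\ (\int[P]_w ((Z v m w) ^+ 2)%:E = (sq v m)%:E)%E,
      (\int[P]_w ((Z v m w) ^+ 4)%:E = (3 * sq v m ^+ 2)%:E)%E &
      (\int[P]_w ((Z v m w) ^+ 6)%:E = (15 * sq v m ^+ 3)%:E)%E].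
Proof.
elim: m => [_|m IH md].
  have Z0 w : Z v 0 w = 0 by apply: big1.
  have -> : sq v 0 = 0 by apply: big1.
  by split; under eq_integral do rewrite Z0 expr0n/=;
    rewrite integral0 ?expr0n/= ?mulr0.
have [I2 I4 I6] := IH (ltnW md).
pose i := Ordinal md; set a := v i ord0.
have sqS : sq v m.+1 = sq v m + a ^+ 2.
  rewrite /sq (bigD1 i)//= ltnSn [in RHS](bigD1 i)//= ltnn add0r addrC.
  congr (_ + _); apply: eq_bigr => j im.
  by rewrite ltnS leq_eqVlt -val_eqE/= in im *; rewrite (negbTE im).
have mZ c n : measurable_fun setT (fun w => (c * Z v m w ^+ n)%:E).
  apply/measurable_EFinP; apply: measurable_funM; first exact: measurable_cst.
  exact/measurable_funX/measurable_ZT.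
have Z0 c n : 0 <= c -> ~~ odd n -> forall w, True -> (0 <= (c * Z v m w ^+ n)%:E)%E.
  by move=> c0 en w _; rewrite lee_fin mulr_ge0 ?exprn_even_ge0.
have Zc c n : 0 <= c -> ~~ odd n ->
    (\int[P]_w (c * Z v m w ^+ n)%:E = c%:E * \int[P]_w (Z v m w ^+ n)%:E)%E.
  move=> c0 en; under eq_integral do rewrite EFinM.
  rewrite ge0_integralZl//; last by move=> w _; rewrite lee_fin exprn_even_ge0.
  exact/measurable_EFinP/measurable_funX/measurable_ZT.
(* All three affine moments are even polynomials in [Z] with nonnegative coefficients, so one
   formula serves them, and nonnegativity justifies splitting the integral. *)
have poly c0 c2 c4 c6 : 0 <= c0 -> 0 <= c2 -> 0 <= c4 -> 0 <= c6 ->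
    (\int[P]_w (c0 + c2 * Z v m w ^+ 2 + c4 * Z v m w ^+ 4
                + c6 * Z v m w ^+ 6)%:E =
     (c0 + c2 * sq v m + c4 * (3 * sq v m ^+ 2) + c6 * (15 * sq v m ^+ 3))%:E)%E.
  move=> ge0 ge2 ge4 ge6.
  have P2 := Z0 _ 2 ge2 isT; have P4 := Z0 _ 4 ge4 isT; have P6 := Z0 _ 6 ge6 isT.
  under eq_integral do rewrite 3!EFinD.
  rewrite ge0_integralD//; last 2 first.
  - by move=> w _; rewrite !adde_ge0 ?P2 ?P4// lee_fin.
  - by apply: emeasurable_funD => //; apply: emeasurable_funD.
  rewrite ge0_integralD//; last 2 first.
  - by move=> w _; rewrite !adde_ge0 ?P2// lee_fin.
  - exact: emeasurable_funD.
  rewrite ge0_integralD//.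
  by rewrite integral_cst//= probability_setT mule1 !Zc// I2 I4 I6 -!EFinM -!EFinD.
have a2 : 0 <= a ^+ 2 by rewrite sqr_ge0.
have a4 : 0 <= a ^+ 4 by rewrite exprn_even_ge0.
have a6 : 0 <= a ^+ 6 by rewrite exprn_even_ge0.
have ge0M k (b : R) : 0 <= b -> 0 <= k%:R * b by exact: mulr_ge0.
split; rewrite (@integral_step v i)//.
- under eq_integral do rewrite integral_normal_prob_affine2.
  transitivity (\int[P]_w (a ^+ 2 + 1 * Z v m w ^+ 2 + 0 * Z v m w ^+ 4
                + 0 * Z v m w ^+ 6)%:E)%E.
    by apply: eq_integral => w _; congr EFin; rewrite -/a; ring.
  by rewrite poly// sqS; congr EFin; ring.
- under eq_integral do rewrite integral_normal_prob_affine4.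
  transitivity (\int[P]_w (3 * a ^+ 4 + 6 * a ^+ 2 * Z v m w ^+ 2
                + 1 * Z v m w ^+ 4 + 0 * Z v m w ^+ 6)%:E)%E.
    by apply: eq_integral => w _; congr EFin; rewrite -/a; ring.
  by rewrite poly ?ge0M// sqS; congr EFin; ring.
- under eq_integral do rewrite integral_normal_prob_affine6.
  transitivity (\int[P]_w (15 * a ^+ 6 + 45 * a ^+ 4 * Z v m w ^+ 2
                + 15 * a ^+ 2 * Z v m w ^+ 4 + 1 * Z v m w ^+ 6)%:E)%E.
    by apply: eq_integral => w _; congr EFin; rewrite -/a; ring.
  by rewrite poly ?ge0M// sqS; congr EFin; ring.
Qed.

Lemma gaussian_dot_moments (v : 'cV[R]_d) :
  [/\ (\int[P]_w (dot v (X w) ^+ 2)%:E = (dot v v)%:E)%E,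
      (\int[P]_w (dot v (X w) ^+ 4)%:E = (3 * dot v v ^+ 2)%:E)%E &
      (\int[P]_w (dot v (X w) ^+ 6)%:E = (15 * dot v v ^+ 3)%:E)%E].
Proof.
have -> : dot v v = sq v d.
  by apply: eq_bigr => i _; rewrite ltn_ord -expr2.
have E w : dot v (X w) = Z v d w.
  by apply: eq_bigr => i _; rewrite ltn_ord.
have [I2 I4 I6] := moments_step v (leqnn d).
by split; under eq_integral do rewrite E.
Qed.

End gaussian_vector.

(** * Positive semidefinite matrices *)

Section dot_product.
Context {R : realType} {d : nat}.
Implicit Types (x y z : 'cV[R]_d) (A : 'M[R]_d).

Lemma dotE x y : dot x y = (x^T *m y) ord0 ord0.
Proof. by rewrite mxE; apply: eq_bigr => i _; rewrite mxE. Qed.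

Lemma dotC x y : dot x y = dot y x.
Proof. by apply: eq_bigr => i _; rewrite mulrC. Qed.

Lemma dotDr x y z : dot x (y + z) = dot x y + dot x z.
Proof. by rewrite !dotE mulmxDr mxE. Qed.

Lemma dotZr x (a : R) y : dot x (a *: y) = a * dot x y.
Proof. by rewrite !dotE -scalemxAr mxE. Qed.

Lemma dotDl x y z : dot (x + y) z = dot x z + dot y z.
Proof. by rewrite dotC dotDr !(dotC z). Qed.

Lemma dotZl (a : R) x y : dot (a *: x) y = a * dot x y.
Proof. by rewrite dotC dotZr dotC. Qed.

Lemma dotNr x y : dot x (- y) = - dot x y.
Proof. by rewrite -scaleN1r dotZr mulN1r. Qed.

Lemma dotNl x y : dot (- x) y = - dot x y.
Proof. by rewrite dotC dotNr dotC. Qed.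

Lemma dot_basisl i x : dot (basis_vec i) x = x i ord0.
Proof.
rewrite /dot (bigD1 i)//= big1 => [|j ji]; rewrite mxE ?eqxx ?mul1r ?addr0//.
by rewrite (negbTE ji) mul0r.
Qed.

Lemma dot_mulmxr x A y : dot x (A *m y) = dot (A^T *m x) y.
Proof. by rewrite !dotE trmx_mul trmxK mulmxA. Qed.

Lemma dot_ge0 x : 0 <= dot x x.
Proof. by apply: sumr_ge0 => i _; rewrite -expr2 sqr_ge0. Qed.

Lemma dot_eq0 x : dot x x = 0 -> x = 0.
Proof.
move=> /eqP; rewrite psumr_eq0 => [/allP x0|i _]; last by rewrite -expr2 sqr_ge0.
apply/matrixP => i j; rewrite (ord1 j) mxE; apply/eqP.
by have := x0 i (mem_index_enum i); rewrite /= mulf_eq0 orbb.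
Qed.

Lemma enorm_sqr x : enorm x ^+ 2 = dot x x.
Proof. by rewrite /enorm sqr_sqrtr ?dot_ge0. Qed.

Lemma mulmx_basis A i j : (A *m basis_vec j) i ord0 = A i j.
Proof.
rewrite mxE (bigD1 j)//= big1 => [|k kj]; rewrite mxE ?eqxx ?mulr1 ?addr0//.
by rewrite (negbTE kj) mulr0.
Qed.

Lemma outerE x y i j : (x *m y^T) i j = x i ord0 * y j ord0.
Proof. by rewrite mxE big_ord1 [y^T _ _]mxE. Qed.

Lemma outer_mulmx x y : (x *m x^T) *m y = dot x y *: x.
Proof.
apply/matrixP => i j; rewrite (ord1 j) !mxE mulr_suml; apply: eq_bigr => k _.
by rewrite mxE big_ord1 mxE; ring.
Qed.

Lemma mxtrace_outer x : \tr (x *m x^T) = dot x x.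
Proof. by rewrite mxtrace_mulC /mxtrace big_ord1 -dotE. Qed.

Definition weighted_outer (s : seq (R * 'cV[R]_d)) : 'M[R]_d :=
  \sum_(c <- s) c.1 *: (c.2 *m c.2^T).

Definition unit_weights (s : seq (R * 'cV[R]_d)) : Prop :=
  forall c, c \in s -> 0 <= c.1 /\ dot c.2 c.2 = 1.

(* Lagrange's reduction: one step of completing the square kills the pivot row
   and column. *)
Lemma psd_decomposition A :
  A^T = A -> (forall x, 0 <= dot x (A *m x)) ->
  exists s, unit_weights s /\ A = weighted_outer s.
Proof.
move=> sA pA.
(* Induction on the number [m] of leading rows allowed to be nonzero; each round clears the last of
   them. *)
suff H m (B : 'M[R]_d) : (m <= d)%N -> B^T = B ->
    (forall x, 0 <= dot x (B *m x)) ->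
    (forall i j : 'I_d, (m <= i)%N -> B i j = 0) ->
    exists s, unit_weights s /\ B = weighted_outer s.
  apply: (H d) => // i j; by rewrite leqNgt ltn_ord.
elim: m B => [B _ sB pB B0|m IH B md sB pB B0].
  exists [::]; split => //; rewrite /weighted_outer big_nil.
  by apply/matrixP => i j; rewrite B0// mxE.
have sBE i j : B i j = B j i by rewrite -{1}sB mxE.
pose p := Ordinal md; pose e : 'cV[R]_d := basis_vec p.
pose u := B *m e; pose a := B p p.
have ueE x : dot e (B *m x) = dot u x by rewrite dot_mulmxr sB.
have upE : dot e u = a by rewrite dot_basisl mulmx_basis.
have quad x t : dot (x + t *: e) (B *m (x + t *: e)) =
    dot x (B *m x) + 2 * t * dot u x + t ^+ 2 * a.
  rewrite mulmxDr -scalemxAr -/u !(dotDl, dotDr, dotZl, dotZr) ueE upE (dotC x u).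
  ring.
have a0 : 0 <= a by have := pB e; rewrite -/u upE.
have [a_eq0|a_neq0] := eqVneq a 0.
  apply: (IH _ (ltnW md) sB pB) => i j; rewrite leq_eqVlt => /predU1P[mi|]; last exact: B0.
  have -> : i = p by apply: val_inj.
  rewrite sBE -(mulmx_basis B j p) -/e -/u -dot_basisl dotC.
  set x := basis_vec j; have /eqP : dot u x = 0.
    apply/eqP/negPn/negP => ux0.
    (* With a zero pivot the form is affine in the step along [e]. A nonzero slope would permit this
       step, where the form equals -1; hence the pivot row is already zero. *)
    have := pB (x + (- (dot x (B *m x) + 1) / (2 * dot u x)) *: e).
    rewrite quad a_eq0 mulr0 addr0.
    have -> : dot x (B *m x) + 2 * (- (dot x (B *m x) + 1) / (2 * dot u x)) *
      dot u x = -1 by field.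
    by rewrite ler0N1.
  by move/eqP.
have {}a0 : 0 < a by rewrite lt_neqAle eq_sym a_neq0.
pose C := B - a^-1 *: (u *m u^T).
have CE x : dot x (C *m x) = dot x (B *m x) - a^-1 * dot u x ^+ 2.
  rewrite mulmxDl mulNmx -scalemxAl outer_mulmx dotDr dotNr !dotZr (dotC x u).
  ring.
have [||i j mi|s [us CsE]] := IH C (ltnW md).
- by rewrite /C linearB/= linearZ/= trmx_mul trmxK sB.
(* This step minimizes the form of [B] along [e], and the minimum is exactly the form of the Schur
   complement [C] at [x]. *)
- move=> x; rewrite CE; have := pB (x + (- (dot u x / a)) *: e).
  rewrite quad; congr (_ <= _); field.
  by rewrite gt_eqF.
- have Bu k : u k ord0 = B k p by rewrite mulmx_basis.
  have -> : C i j = B i j - a^-1 * (B i p * B j p).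
    rewrite -!Bu -outerE /C mxE; congr (_ + _).
    by rewrite mxE; congr (- _); rewrite mxE.
  move: mi; rewrite leq_eqVlt => /predU1P[mi|mi]; last first.
    by rewrite (B0 i j mi) (B0 i p mi) mul0r mulr0 subrr.
  have -> : i = p by apply: val_inj.
  by rewrite (sBE j) -/a mulrA mulVf// mul1r subrr.
have u0 : 0 < dot u u.
  rewrite lt_neqAle dot_ge0 andbT eq_sym; apply/eqP => /dot_eq0 u0.
  by move: upE; rewrite u0 -[0](scale0r e) dotZr mul0r => /eqP; rewrite eq_sym gt_eqF.
(* The removed term [a^-1 *: (u *m u^T)], rewritten with [u] normalized to unit length. *)
exists ((dot u u / a, (Num.sqrt (dot u u))^-1 *: u) :: s); split.
  move=> c; rewrite inE => /predU1P[->/=|]; last exact: us.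
  split; first by rewrite divr_ge0// ltW.
  rewrite dotZl dotZr mulrA -expr2 exprVn sqr_sqrtr ?dot_ge0// mulVf//.
  by rewrite gt_eqF.
rewrite /weighted_outer big_cons -/(weighted_outer s) -CsE /=.
rewrite linearZ/= -scalemxAl -scalemxAr !scalerA.
rewrite -mulrA -expr2 exprVn sqr_sqrtr ?dot_ge0// mulrAC divff ?mul1r ?gt_eqF//.
by rewrite /C addrC subrK.
Qed.

Lemma dot_weighted_outer s x :
  dot x (weighted_outer s *m x) = \sum_(c <- s) c.1 * dot c.2 x ^+ 2.
Proof.
rewrite /weighted_outer mulmx_suml dotE mulmx_sumr summxE; apply: eq_bigr => c _.
by rewrite -dotE -scalemxAl outer_mulmx !dotZr (dotC x); ring.
Qed.

Lemma mxtrace_weighted_outer s :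
  unit_weights s -> \tr (weighted_outer s) = \sum_(c <- s) c.1.
Proof.
move=> us; rewrite /weighted_outer raddf_sum/= !big_seq; apply: eq_bigr => c cs.
by rewrite linearZ/= mxtrace_outer (us c cs).2 mulr1.
Qed.

End dot_product.

(** * Gaussian quadratic forms *)

Section weighted_power_means.
Context {R : realType} {I : eqType} (s : seq I) (b y : I -> R).
Hypotheses (b0 : forall i, i \in s -> 0 <= b i) (y0 : forall i, 0 <= y i).
Let W := \sum_(i <- s) b i.
Let m := (\sum_(i <- s) b i * y i) / W.

Lemma weighted_mean_ge0 : 0 <= \sum_(i <- s) b i * y i.
Proof. by rewrite big_seq sumr_ge0// => i si; rewrite mulr_ge0 ?b0. Qed.

(** The weighted variance about the mean [m] is nonnegative. *)
Lemma weighted_sqr_mean : 0 < W ->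
  (\sum_(i <- s) b i * y i) ^+ 2 <= W * \sum_(i <- s) b i * y i ^+ 2.
Proof.
move=> W0.
have : 0 <= \sum_(i <- s) b i * (y i - m) ^+ 2.
  by rewrite big_seq sumr_ge0// => i si; rewrite mulr_ge0 ?b0 ?sqr_ge0.
have -> : \sum_(i <- s) b i * (y i - m) ^+ 2 =
    \sum_(i <- s) b i * y i ^+ 2 - (2 * m) * (\sum_(i <- s) b i * y i) +
    m ^+ 2 * W.
  rewrite !mulr_sumr -sumrB -big_split/=.
  by apply: eq_bigr => i _; ring.
have -> : \sum_(i <- s) b i * y i = m * W by rewrite mulfVK// gt_eqF.
move: (\sum_(i <- s) _) => S; rewrite -(ler_pM2l W0) mulr0; nra.
Qed.

(* [y ^ 3 - 3 m ^ 2 y + 2 m ^ 3 = (y - m) ^ 2 (y + 2 m)] *)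
Lemma weighted_cube_mean : 0 < W ->
  (\sum_(i <- s) b i * y i) ^+ 3 <= W ^+ 2 * \sum_(i <- s) b i * y i ^+ 3.
Proof.
move=> W0.
have m0 : 0 <= m by rewrite divr_ge0 ?weighted_mean_ge0 ?ltW.
have : 0 <= \sum_(i <- s) b i * ((y i - m) ^+ 2 * (y i + 2 * m)).
  rewrite big_seq sumr_ge0// => i si.
  apply: mulr_ge0; first exact: b0.
  apply: mulr_ge0; first exact: sqr_ge0.
  by apply: addr_ge0 => //; apply: mulr_ge0.
have -> : \sum_(i <- s) b i * ((y i - m) ^+ 2 * (y i + 2 * m)) =
    \sum_(i <- s) b i * y i ^+ 3 - (3 * m ^+ 2) * (\sum_(i <- s) b i * y i) +
    (2 * m ^+ 3) * W.
  rewrite !mulr_sumr -sumrB -big_split/=.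
  by apply: eq_bigr => i _; ring.
have -> : \sum_(i <- s) b i * y i = m * W by rewrite mulfVK// gt_eqF.
move: (\sum_(i <- s) _) => S.
have W2 : 0 < W ^+ 2 by rewrite exprn_gt0.
rewrite -(ler_pM2l W2) mulr0 -subr_ge0 => H; rewrite -subr_ge0.
by apply: le_trans H _; rewrite le_eqVlt; apply/orP; left; apply/eqP; ring.
Qed.

End weighted_power_means.

(** * Coordinatewise measurability of random vectors *)

Section measurable_dot.
Context {disp : measure_display} {T : measurableType disp} {R : realType}.
Context {d : nat}.
Implicit Types U V : T -> 'cV[R]_d.

Lemma measurable_dot U V : measurable_vec U -> measurable_vec V ->
  measurable_fun setT (fun w => dot (U w) (V w)).
Proof.
by move=> mU mV; apply: measurable_sum => i; exact: measurable_funM.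
Qed.

Lemma measurable_vec_cst (v : 'cV[R]_d) : measurable_vec (fun _ : T => v).
Proof. by move=> i; exact: measurable_cst. Qed.

Lemma measurable_vec_mulmx (A : 'M[R]_d) U :
  measurable_vec U -> measurable_vec (fun w => A *m U w).
Proof.
move=> mU i; under eq_fun do rewrite mxE.
by apply: measurable_sum => j; apply: measurable_funM => //; exact: measurable_cst.
Qed.

Lemma measurable_vecD U V : measurable_vec U -> measurable_vec V ->
  measurable_vec (fun w => U w + V w).
Proof.
move=> mU mV i; under eq_fun do rewrite mxE.
exact: measurable_funD.
Qed.

End measurable_dot.

(** * Moments of a Gaussian quadratic form *)

Section gaussian_quadratic_form.
Context {disp : measure_display} {T : measurableType disp} {R : realType}.
Variables (P : probability T R) (d : nat) (X : T -> 'cV[R]_d) (A : 'M[R]_d).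
Hypotheses (gX : std_gaussian P X) (sA : A^T = A).
Hypotheses (pA : forall x, 0 <= dot x (A *m x)) (trA : 0 < \tr A).

Let mX : measurable_vec X := gX.1.

Let weighted_moment (s : seq (R * 'cV[R]_d)) n (c : R) : ~~ odd n ->
  unit_weights s ->
  (forall v, dot v v = 1 -> (\int[P]_w (dot v (X w) ^+ n)%:E = c%:E)%E) ->
  (\int[P]_w (\sum_(a <- s) a.1 * dot a.2 (X w) ^+ n)%:E =
   (c * \sum_(a <- s) a.1)%:E)%E.
Proof.
move=> en us Ic.
have mn v : measurable_fun setT (fun w => (dot v (X w) ^+ n)%:E).
  apply/measurable_EFinP/measurable_funX.
  exact: (measurable_dot (measurable_vec_cst v) mX).
elim: s us => [_|a s IH us].
  under eq_integral do rewrite big_nil.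
  by rewrite integral0 big_nil mulr0.
have [a0 a1] := us a (mem_head _ _).
have us' : unit_weights s by move=> e es; apply: us; rewrite inE es orbT.
have s0 w : 0 <= \sum_(a <- s) a.1 * dot a.2 (X w) ^+ n.
  rewrite big_seq sumr_ge0// => e es.
  by rewrite mulr_ge0 ?exprn_even_ge0// (us' _ es).1.
under eq_integral do rewrite big_cons EFinD EFinM.
rewrite ge0_integralD//.
- rewrite IH// ge0_integralZl//; last first.
    by move=> w _; rewrite lee_fin exprn_even_ge0.
  by rewrite Ic// big_cons -EFinM -EFinD mulrDr (mulrC a.1).
- by move=> w _; rewrite -EFinM lee_fin mulr_ge0// exprn_even_ge0.
- by apply: emeasurable_funM => //; exact: measurable_cst.
- by move=> w _; rewrite lee_fin.
- apply/measurable_EFinP; apply: measurable_sum => e.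
  apply: measurable_funM; first exact: measurable_cst.
  apply/measurable_funX; exact: (measurable_dot (measurable_vec_cst _) mX).
Qed.

Let q w := dot (X w) (A *m X w).

Let mq : measurable_fun setT q.
Proof. exact: (measurable_dot mX (measurable_vec_mulmx A mX)). Qed.

Lemma gaussian_quadratic_form_moments :
  [/\ (\int[P]_w (q w)%:E = (\tr A)%:E)%E,
      (\int[P]_w (q w ^+ 2)%:E <= (3 * \tr A ^+ 2)%:E)%E,
      (\int[P]_w (q w ^+ 3)%:E <= (15 * \tr A ^+ 3)%:E)%E &
      forall g, (\int[P]_w (dot g (X w) ^+ 2 * q w)%:E <=
        (3 * \tr A * dot g g)%:E)%E].
Proof.
have [s [us As]] := psd_decomposition sA pA.
have trE := mxtrace_weighted_outer us; rewrite -As in trE.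
have qE w : q w = \sum_(a <- s) a.1 * dot a.2 (X w) ^+ 2.
  by rewrite /q As dot_weighted_outer.
have b0 a : a \in s -> 0 <= a.1 by move=> /us[].
have W0 : 0 < \sum_(a <- s) a.1 by rewrite -trE.
have I2 : (\int[P]_w (\sum_(a <- s) a.1 * dot a.2 (X w) ^+ 2)%:E =
    (1 * \tr A)%:E)%E.
  rewrite trE; apply: weighted_moment => // v v1.
  by have [-> _ _] := gaussian_dot_moments gX v; rewrite v1.
have I4 : (\int[P]_w (\sum_(a <- s) a.1 * dot a.2 (X w) ^+ 4)%:E =
    (3 * \tr A)%:E)%E.
  rewrite trE; apply: weighted_moment => // v v1.
  by have [_ -> _] := gaussian_dot_moments gX v; rewrite v1 expr1n mulr1.
have I6 : (\int[P]_w (\sum_(a <- s) a.1 * dot a.2 (X w) ^+ 6)%:E =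
    (15 * \tr A)%:E)%E.
  rewrite trE; apply: weighted_moment => // v v1.
  by have [_ _ ->] := gaussian_dot_moments gX v; rewrite v1 expr1n mulr1.
have ms n : measurable_fun setT
    (fun w => (\sum_(a <- s) a.1 * dot a.2 (X w) ^+ n)%:E).
  apply/measurable_EFinP; apply: measurable_sum => e.
  apply: measurable_funM; first exact: measurable_cst.
  apply/measurable_funX; exact: (measurable_dot (measurable_vec_cst _) mX).
have s0 n w : ~~ odd n -> 0 <= \sum_(a <- s) a.1 * dot a.2 (X w) ^+ n.
  move=> en; rewrite big_seq sumr_ge0// => e es.
  by rewrite mulr_ge0 ?exprn_even_ge0// b0.
have q0 w : 0 <= q w by exact: pA.
have powE k w : \sum_(a <- s) a.1 * (dot a.2 (X w) ^+ 2) ^+ k =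
    \sum_(a <- s) a.1 * dot a.2 (X w) ^+ (2 * k).
  by apply: eq_bigr => a _; rewrite exprM.
have mqn n : measurable_fun setT (fun w => (q w ^+ n)%:E).
  exact/measurable_EFinP/measurable_funX.
split.
- by under eq_integral do rewrite qE; rewrite I2 mul1r.
- apply: (@le_trans _ _ (\int[P]_w ((\tr A)%:E *
      (\sum_(a <- s) a.1 * dot a.2 (X w) ^+ 4)%:E))%E).
    apply: ge0_le_integral => //.
    + by move=> w _; rewrite lee_fin exprn_ge0.
    + by apply: emeasurable_funM => //; exact: measurable_cst.
    + move=> w _; rewrite -EFinM lee_fin qE trE -(powE 2).
      by apply: weighted_sqr_mean => // a; exact: sqr_ge0.
  rewrite ge0_integralZl//; last 2 first.
  + by move=> w _; rewrite lee_fin s0.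
  + by rewrite lee_fin ltW.
  by rewrite I4 -EFinM lee_fin le_eqVlt; apply/orP; left; apply/eqP; ring.
- apply: (@le_trans _ _ (\int[P]_w ((\tr A ^+ 2)%:E *
      (\sum_(a <- s) a.1 * dot a.2 (X w) ^+ 6)%:E))%E).
    apply: ge0_le_integral => //.
    + by move=> w _; rewrite lee_fin exprn_ge0.
    + by apply: emeasurable_funM => //; exact: measurable_cst.
    + move=> w _; rewrite -EFinM lee_fin qE trE -(powE 3).
      by apply: weighted_cube_mean => // a; exact: sqr_ge0.
  rewrite ge0_integralZl//; last 2 first.
  + by move=> w _; rewrite lee_fin s0.
  + by rewrite lee_fin sqr_ge0.
  by rewrite I6 -EFinM lee_fin le_eqVlt; apply/orP; left; apply/eqP; ring.
(* The case [g = 0] is separate because the Young weights below divide by [dot g g]. *)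
- move=> g; have [g0|g_neq0] := eqVneq (dot g g) 0.
    have -> : g = 0 by exact: dot_eq0.
    have E w : dot 0 (X w) ^+ 2 * q w = 0.
      by rewrite -[0](scale0r g) dotZl mul0r expr0n mul0r.
    under eq_integral do rewrite E.
    by rewrite integral0 lee_fin !mulr_ge0// ?dot_ge0// ltW.
  have gg0 : 0 < dot g g by rewrite lt_neqAle eq_sym g_neq0 dot_ge0.
  (* Young's inequality [t^2 y^2 <= t^4 / (2 |g|^2) + |g|^2 y^4 / 2], summed over the decomposition
     of [A]. These weights give both terms the same expectation, as [E t^4 = 3 |g|^4] and
     [E y^4 = 3]. *)
  pose c1 := \tr A / (2 * dot g g); pose c2 := dot g g / 2.
  have c10 : 0 <= c1 by rewrite divr_ge0 ?mulr_ge0// ltW.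
  have c20 : 0 <= c2 by rewrite divr_ge0// ltW.
  have mg n : measurable_fun setT (fun w => (dot g (X w) ^+ n)%:E).
    apply/measurable_EFinP/measurable_funX.
    exact: (measurable_dot (measurable_vec_cst g) mX).
  apply: (@le_trans _ _ (\int[P]_w (c1%:E * (dot g (X w) ^+ 4)%:E +
      c2%:E * (\sum_(a <- s) a.1 * dot a.2 (X w) ^+ 4)%:E))%E).
    apply: ge0_le_integral => //.
    + by move=> w _; rewrite lee_fin mulr_ge0 ?sqr_ge0.
    + apply/measurable_EFinP; apply: measurable_funM; last exact: mq.
      by have /measurable_EFinP := mg 2.
    + by apply: emeasurable_funD; apply: emeasurable_funM => //; exact: measurable_cst.
    + move=> w _; rewrite -!EFinM -EFinD lee_fin qE.
      set t := dot g (X w).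
      have -> : c1 * t ^+ 4 = \sum_(a <- s) a.1 * (t ^+ 4 / (2 * dot g g)).
        by rewrite -mulr_suml -trE /c1; field.
      rewrite [c2 * _]mulr_sumr [t ^+ 2 * _]mulr_sumr -big_split/= !big_seq.
      apply: ler_sum => a sa; rewrite -subr_ge0.
      set y := dot a.2 (X w).
      rewrite (_ : _ - _ =
        a.1 * (t ^+ 2 - dot g g * y ^+ 2) ^+ 2 / (2 * dot g g)); last first.
        by rewrite /c2; field.
      apply: divr_ge0; last by apply: mulr_ge0 => //; exact: ltW.
      by apply: mulr_ge0; [exact: b0|exact: sqr_ge0].
  rewrite ge0_integralD//; last 4 first.
  + by move=> w _; rewrite mule_ge0 ?lee_fin ?exprn_even_ge0.
  + by apply: emeasurable_funM => //; exact: measurable_cst.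
  + by move=> w _; rewrite mule_ge0 ?lee_fin ?s0.
  + by apply: emeasurable_funM => //; exact: measurable_cst.
  rewrite !ge0_integralZl//; last 2 first.
  + by move=> w _; rewrite lee_fin s0.
  + by move=> w _; rewrite lee_fin exprn_even_ge0.
  have [_ -> _] := gaussian_dot_moments gX g.
  rewrite I4 -!EFinM -EFinD lee_fin /c1 /c2 le_eqVlt; apply/orP; left; apply/eqP.
  by field.
Qed.

End gaussian_quadratic_form.

(** * Quadratic functions *)

Section quadratic_functions.
Context {R : realType} {d : nat}.
Implicit Types (x y v : 'cV[R]_d) (f : 'cV[R]_d -> R).

(** The difference quotient is exactly [l + t * c] for [t != 0]. *)
Lemma derive_quadratic_expansion f x v (l c : R) :
  (forall t, f (t *: v + x) = f x + t * l + t ^+ 2 * c) -> 'D_v f x = l.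
Proof.
move=> fE; apply/cvg_lim => //.
have H : (fun t : R => l + t * c) @ 0^' --> l.
  rewrite -[X in _ --> X]addr0 -[X in _ --> l + X](mul0r c).
  apply: cvg_trans (_ : (fun t : R => l + t * c) @ 0 --> l + 0 * c).
    by apply: cvg_app; exact: cvg_within.
  by apply: cvgD; [exact: cvg_cst|apply: cvgM; [exact: cvg_id|exact: cvg_cst]].
apply: cvg_trans H; apply: near_eq_cvg; near=> t.
have t0 : t != 0 by near: t; exact: nbhs_dnbhs_neq.
by rewrite /= fE /GRing.scale/=; field.
Unshelve. all: by end_near. Qed.

Variables (f : 'cV[R]_d -> R) (A : 'M[R]_d).
Hypotheses (quad_f : quadratic f) (hess_f : forall x, hessian f x = A).

(** The matrix [Q] of a quadratic function may be asymmetric, so the Hessian is its symmetrization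
    [Q + Q^T]. The exact second-order expansion yields all directional derivatives, and
    differentiating once more identifies [A]. *)
Let quadratic_calculus : exists b, A^T = A /\
  (forall x, grad f x = A *m x + b) /\
  forall x y, f (x + y) = f x + dot (grad f x) y + 2^-1 * dot y (A *m y).
Proof.
have [Q [b [c fE]]] := quad_f.
pose H := Q + Q^T.
have HT : H^T = H by rewrite /H linearD/= trmxK addrC.
have dotH y : dot y (H *m y) = 2 * dot y (Q *m y).
  rewrite mulmxDl dotDr (dot_mulmxr y Q^T) trmxK (dotC (Q *m y)); ring.
have fD x y : f (x + y) = f x + dot (H *m x + b) y + 2^-1 * dot y (H *m y).
  rewrite dotH !fE mulmxDr !(dotDl, dotDr) mulmxDl dotDl (dotC (Q^T *m x)).
  rewrite (dot_mulmxr y Q^T) trmxK (dotC (Q *m x) y) (dotC (Q *m y) x).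
  by field.
have D v x : 'D_v f x = dot (H *m x + b) v.
  apply: (@derive_quadratic_expansion _ _ _ _ (2^-1 * dot v (H *m v))) => t.
  by rewrite addrC fD -scalemxAr dotZr dotZl dotZr; ring.
have gE x : grad f x = H *m x + b.
  apply/matrixP => i j; rewrite (ord1 j) [LHS]mxE D dotC.
  exact: dot_basisl.
have AE : A = H.
  rewrite -(hess_f 0); apply/matrixP => i j; rewrite [LHS]mxE.
  rewrite (_ : (fun y => _) = fun y => dot (H *m y + b) (basis_vec j)); last first.
    by apply/funext => y; rewrite D.
  rewrite (@derive_quadratic_expansion _ _ _ (H j i) 0) => [|t].
    by rewrite -[in LHS]HT mxE.
  rewrite mulmxDr -scalemxAr -addrA dotDl dotZl mulr0 addr0.
  rewrite 2!(dotC _ (basis_vec j)) !dot_basisl mulmx_basis; exact: addrC.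
exists b; rewrite AE; split => //; split => // x y.
by rewrite fD gE.
Qed.

Lemma hessian_sym : A^T = A.
Proof. by have [b []] := quadratic_calculus. Qed.

Lemma grad_affine : exists b, forall x, grad f x = A *m x + b.
Proof. by have [b [_ [gE _]]] := quadratic_calculus; exists b. Qed.

Lemma quadratic_taylor x y :
  f (x + y) = f x + dot (grad f x) y + 2^-1 * dot y (A *m y).
Proof. by have [b [_ [_ ->]]] := quadratic_calculus. Qed.

Variables (mu fstar : R).
Hypotheses (mu0 : 0 < mu) (sc_f : strongly_convex mu f).
Hypothesis min_f : is_minimum f fstar.

(** Comparing strong convexity at 0 with the exact expansion cancels the linear terms. *)
Lemma hessian_lower_bound v : mu * dot v v <= dot v (A *m v).
Proof.
have := sc_f 0 (0 + v); rewrite quadratic_taylor subr0 !add0r.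
rewrite -enorm_sqr.
have -> : enorm (- v) = enorm v by rewrite /enorm dotNl dotNr opprK.
lra.
Qed.

Lemma hessian_psd v : 0 <= dot v (A *m v).
Proof.
by apply: le_trans (hessian_lower_bound v); rewrite mulr_ge0 ?dot_ge0 ?ltW.
Qed.

Lemma hessian_trace_gt0 : (0 < d)%N -> 0 < \tr A.
Proof.
move=> d0; have Aii i : mu <= A i i.
  have := hessian_lower_bound (basis_vec i).
  by rewrite !dot_basisl mulmx_basis mxE !eqxx mulr1.
apply: (@lt_le_trans _ _ (\sum_(i < d) mu)); last exact: ler_sum.
by rewrite sumr_const card_ord pmulrn_lgt0.
Qed.

(** Cauchy-Schwarz for each unit vector of the decomposition, whose weights sum to the trace. *)
Lemma hessian_upper_bound v : dot v (A *m v) <= \tr A * dot v v.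
Proof.
have [s [us As]] := psd_decomposition hessian_sym hessian_psd.
rewrite As dot_weighted_outer (mxtrace_weighted_outer us) mulr_suml !big_seq.
apply: ler_sum => c cs; have [c0 c1] := us c cs; rewrite ler_wpM2l//.
(* The component of [v] orthogonal to the unit vector [c.2]. *)
have := dot_ge0 (v + (- dot c.2 v) *: c.2).
by rewrite !(dotDl, dotDr, dotZl, dotZr) c1 (dotC v); nra.
Qed.

(** The strong convexity lower bound is evaluated at a minimizer, and the square of [g + mu *: z] is
    completed. *)
Lemma polyak_lojasiewicz x : 2 * mu * (f x - fstar) <= dot (grad f x) (grad f x).
Proof.
have [[y <-] _] := min_f.
have := sc_f x y; rewrite enorm_sqr.
set g := grad f x; have -> : x - y = - (y - x) by rewrite opprB.
move: (y - x) => z; rewrite dotNl dotNr opprK => fy.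
have := dot_ge0 (g + mu *: z).
rewrite !(dotDl, dotDr, dotZl, dotZr) (dotC z g) => H.
have := ler_wpM2l (ltW mu0) fy; lra.
Qed.

(** A gradient step of length [1 / \tr A] decreases [f] by at least [|g|^2 / (2 \tr A)] and cannot
    pass below [fstar]. This later makes the expected squared gradient finite. *)
Lemma grad_upper_bound x : 0 < \tr A ->
  dot (grad f x) (grad f x) <= 2 * \tr A * (f x - fstar).
Proof.
move=> trA; have [_ min] := min_f.
set g := grad f x; have := min (x + (- (\tr A)^-1) *: g).
rewrite quadratic_taylor -/g -scalemxAr dotZr dotZl dotZr => H.
have := hessian_upper_bound g; move: H.
set G := dot g g; set GA := dot g (A *m g); set t := \tr A => H1 H2.
have : fstar <= f x - G / (2 * t).
  apply: le_trans H1 _; rewrite -subr_ge0.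
  rewrite (_ : _ - _ = (t * G - GA) / (2 * t ^+ 2)); last by field; rewrite gt_eqF.
  by apply: divr_ge0; [rewrite subr_ge0|rewrite mulr_ge0// exprn_ge0// ltW].
rewrite -subr_ge0 => H3.
have := mulr_ge0 (ltW trA) H3.
rewrite (_ : t * (f x - G / (2 * t) - fstar) = t * (f x - fstar) - G / 2); last first.
  by field; rewrite gt_eqF.
by rewrite -/t; lra.
Qed.

(* With [s = <g, xi>], [q = xi^T A xi] and oracle error [e], the finite
   difference is [s + r], [r = rho q / 2 + e / rho]; then [(s + r) s] and
   [(s + r) ^ 2] are bounded by Young's inequality, and
   [r ^ 2 <= (rho q) ^ 2 + 4 / 3 * (e / rho) ^ 2]. *)
Lemma random_step_descent (rho delta h : R) (fo : 'cV[R]_d -> R) x xi :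
  0 < rho -> 0 <= h -> approx_oracle delta f fo ->
  let q := dot xi (A *m xi) in let s := dot (grad f x) xi in
  let K := 16 / 3 * (delta ^+ 2 / rho ^+ 2) in
  is_true (
    f (x - (h * ((fo (x + rho *: xi) - fo x) / rho)) *: xi) + h / 2 * s ^+ 2 <=
    f x + h ^+ 2 * (s ^+ 2 * q) + rho ^+ 2 * h / 2 * q ^+ 2
    + rho ^+ 2 * h ^+ 2 * q ^+ 3 + K * h / 2 + K * h ^+ 2 * q).
Proof.
move=> rho0 h0 of_f q s K.
pose e := (fo (x + rho *: xi) - f (x + rho *: xi)) - (fo x - f x).
have eb : e ^+ 2 <= 4 * delta ^+ 2.
  have := of_f x; have := of_f (x + rho *: xi); rewrite !ler_norml /e.
  move: (fo _ - f _) (fo _ - f _) => a b /andP[? ?] /andP[? ?]; nra.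
have rho_neq0 : rho != 0 by rewrite gt_eqF.
pose r := rho / 2 * q + e / rho.
have -> : (fo (x + rho *: xi) - fo x) / rho = s + r.
  have -> : fo (x + rho *: xi) - fo x = e + (f (x + rho *: xi) - f x).
    by rewrite /e; ring.
  rewrite quadratic_taylor -scalemxAr !(dotZl, dotZr) -/s -/q /r.
  by field.
have rb : r ^+ 2 <= rho ^+ 2 * q ^+ 2 + K.
  have -> : K = 4 / 3 * (4 * delta ^+ 2 / rho ^+ 2) by rewrite /K; field.
  have er : (e / rho) ^+ 2 <= 4 * delta ^+ 2 / rho ^+ 2.
    by rewrite expr_div_n ler_wpM2r// invr_ge0 sqr_ge0.
  have := sqr_ge0 (3 * (rho / 2 * q) - e / rho).
  by rewrite /r; move: (e / rho) er => t er; nra.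
rewrite -scaleNr quadratic_taylor -scalemxAr !(dotZl, dotZr) -/s -/q.
have q0 : 0 <= q by exact: hessian_psd.
have h1 : h * r ^+ 2 <= h * (rho ^+ 2 * q ^+ 2 + K) by rewrite ler_wpM2l.
have h2 : h ^+ 2 * q * r ^+ 2 <= h ^+ 2 * q * (rho ^+ 2 * q ^+ 2 + K).
  by rewrite ler_wpM2l// mulr_ge0// sqr_ge0.
(* [h3] encodes [- (s + r) s <= (r^2 - s^2) / 2] and [h4] encodes [(s + r)^2 <= 2 s^2 + 2 r^2], each
   multiplied by its factor in the expansion. *)
have h3 : 0 <= h * (s + r) ^+ 2 by rewrite mulr_ge0 ?sqr_ge0.
have h4 : 0 <= h ^+ 2 * q * (s - r) ^+ 2.
  by apply: mulr_ge0; rewrite ?sqr_ge0// mulr_ge0 ?sqr_ge0.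
lra.
Qed.

End quadratic_functions.

(** * Measurability and independence of the iterates *)

Section random_gradient_method.
Context {disp : measure_display} {T : measurableType disp} {R : realType}.
Context {d : nat}.
Variables (P : probability T R) (h : nat -> R) (rho : R) (x0 : 'cV[R]_d).
Variables (fo : nat -> T -> 'cV[R]_d -> R) (xi : nat -> T -> 'cV[R]_d).
Hypothesis rnd : RG_randomness h rho x0 fo xi P.

Let gens (k : nat) : set (set T) :=
  \bigcup_(j in `I_k)
    (events_of_vec (xi j) `|` events_of (RG_answer h rho x0 fo xi j)
       `|` events_of (RG_answer_shift h rho x0 fo xi j)).

Let events_of_vec_measurable k : events_of_vec (xi k) `<=` measurable.
Proof.
have [gx _ _ _] := rnd.
by move=> _ [i _ [B mB <-]]; exact: (gx k).1.
Qed.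

Let gens_measurable k : gens k `<=` measurable.
Proof.
have [_ _ ma ms] := rnd.
move=> A [j _ [[]|]]; first exact: events_of_vec_measurable.
- by move=> [B mB <-]; exact: ma.
- by move=> [B mB <-]; exact: ms.
Qed.

(** The sample space under two smaller sigma-algebras: independence of past and direction becomes
    independence of the identity maps into [past k] and [present k]. *)
Let past k : measurableType _ := g_sigma_algebraType (gens k).
Let present k : measurableType _ := g_sigma_algebraType (events_of_vec (xi k)).

Let measurable_past (X : T -> R) k : events_of X `<=` gens k ->
  measurable_fun (setT : set (past k)) X.
Proof.
by move=> Xk _ B mB; apply: sub_sigma_algebra; apply: Xk; exists B.
Qed.

Let measurable_pastS (X : T -> R) k :
  measurable_fun (setT : set (past k)) X ->
  measurable_fun (setT : set (past k.+1)) X.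
Proof.
move=> mX _ B mB; apply: sub_sigma_algebra2 (mX _ _ mB) => //.
by apply: bigcup_subset => j /= /ltnW.
Qed.

(** The update is arithmetic in the previous iterate, the direction and the two oracle answers, all
    measurable for [past k.+1]; the oracle enters only through those answers. *)
Let measurable_RG_past k : @measurable_vec _ (past k) R d (RG h rho x0 fo xi k).
Proof.
elim: k => [|k IH] i /=; first exact: measurable_cst.
have kk : (k < k.+1)%N by [].
have mxi : measurable_fun (setT : set (past k.+1)) (fun w => xi k w i ord0).
  by apply: measurable_past => A Ak; exists k => //; left; left; exists i.
have ma : measurable_fun (setT : set (past k.+1)) (RG_answer h rho x0 fo xi k).
  by apply: measurable_past => A Ak; exists k => //; left; right.
have ms : measurable_fun (setT : set (past k.+1))
    (RG_answer_shift h rho x0 fo xi k).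
  by apply: measurable_past => A Ak; exists k => //; right.
rewrite (_ : (fun w => _) = fun w => RG h rho x0 fo xi k w i ord0 -
    h k * ((RG_answer_shift h rho x0 fo xi k w - RG_answer h rho x0 fo xi k w)
      / rho) * xi k w i ord0); last by apply/funext => w; rewrite !mxE.
apply: measurable_funB; first exact: measurable_pastS.
apply: measurable_funM => //; apply: measurable_funM; first exact: measurable_cst.
apply: measurable_funM; last exact: measurable_cst.
exact: measurable_funB.
Qed.

Lemma measurable_RG k : measurable_vec (RG h rho x0 fo xi k).
Proof.
move=> i _ B mB; apply: (sigma_sub_measurable (@gens_measurable k)).
exact: measurable_RG_past.
Qed.

Let measurable_present k : @measurable_vec _ (present k) R d (xi k).
Proof.
by move=> i _ B mB; apply: sub_sigma_algebra; exists i => //; exists B.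
Qed.

Section frozen_iterate.
Variables (k : nat) (Phi : 'cV[R]_d -> 'cV[R]_d -> \bar R).
(** Measurability of [Phi] is phrased through composition with coordinatewise measurable vectors;
    quantifying over [U] lets it apply on the product of [past k] and [present k]. *)
Hypothesis mPhi : forall d' (U : measurableType d') (X Y : U -> 'cV[R]_d),
  measurable_vec X -> measurable_vec Y ->
  measurable_fun setT (fun u => Phi (X u) (Y u)).
Hypothesis Phi0 : forall x y, (0 <= Phi x y)%E.

Let mid1 : measurable_fun (setT : set T) (id : T -> past k).
Proof.
move=> _ A mA; rewrite setTI.
exact: (sigma_sub_measurable (@gens_measurable k)).
Qed.

Let mid2 : measurable_fun (setT : set T) (id : T -> present k).
Proof.
move=> _ A mA; rewrite setTI.
exact: (sigma_sub_measurable (@events_of_vec_measurable k)).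
Qed.

Let mPhi_RG : measurable_fun (setT : set (past k * present k)%type)
  (fun z => Phi (RG h rho x0 fo xi k z.1) (xi k z.2)).
Proof.
apply: mPhi => i.
- exact: (measurableT_comp (@measurable_RG_past k i)).
- exact: (measurableT_comp (@measurable_present k i)).
Qed.

Lemma RG_tonelli :
  (\int[P]_w Phi (RG h rho x0 fo xi k w) (xi k w) =
   \int[P]_w1 \int[P]_w2 Phi (RG h rho x0 fo xi k w1) (xi k w2))%E.
Proof.
have [_ ind _ _] := rnd.
apply: (independent_tonelli mid1 mid2 _ mPhi_RG) => //.
by move=> A B mA mB; exact: (ind k A B mA mB).
Qed.

Lemma measurable_RG_average :
  measurable_fun setT
    (fun w => \int[P]_w' Phi (RG h rho x0 fo xi k w) (xi k w'))%E.
Proof. by apply: (measurable_partial_integral P mid1 mid2 mPhi_RG). Qed.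

End frozen_iterate.

End random_gradient_method.

(** * The descent inequality *)

Section one_step.
Context {disp : measure_display} {T : measurableType disp} {R : realType}.
Context {d : nat}.
Variables (P : probability T R) (f : 'cV[R]_d -> R) (A : 'M[R]_d).
Variables (mu fstar rho delta : R) (x0 : 'cV[R]_d).
Variables (fo : nat -> T -> 'cV[R]_d -> R) (xi : nat -> T -> 'cV[R]_d).
Hypotheses (quad_f : quadratic f) (hess_f : forall x, hessian f x = A).
Hypotheses (mu0 : 0 < mu) (sc_f : strongly_convex mu f).
Hypothesis min_f : is_minimum f fstar.
Hypotheses (rho0 : 0 < rho) (d0 : (0 < d)%N).
Hypothesis of_f : forall k w, approx_oracle delta f (fo k w).

Let h : nat -> R := fun=> 1 / (12 * \tr A).
Hypothesis rnd : RG_randomness h rho x0 fo xi P.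
Let x := RG h rho x0 fo xi.
Let F k w := f (x k w) - fstar.
Let C1 := 5 / 16 * \tr A * d%:R + 5 / 384 * \tr A.
Let C2 := d%:R / (3 * \tr A) + 1 / (72 * \tr A).

Let trA : 0 < \tr A. Proof. exact: (hessian_trace_gt0 quad_f hess_f mu0 sc_f d0). Qed.

Lemma excess_ge0 k w : 0 <= F k w.
Proof. by rewrite subr_ge0; exact: min_f.2. Qed.

Lemma measurable_quadratic d' (U : measurableType d') (X : U -> 'cV[R]_d) :
  measurable_vec X -> measurable_fun setT (fun u => f (X u)).
Proof.
have [Q [b [c fE]]] := quad_f => mX.
under eq_fun do rewrite fE.
apply: measurable_funD; last exact: measurable_cst.
apply: measurable_funD.
- exact: (measurable_dot mX (measurable_vec_mulmx Q mX)).
- exact: (measurable_dot (measurable_vec_cst b) mX).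
Qed.

Lemma measurable_excess k : measurable_fun setT (F k).
Proof.
apply: measurable_funB; last exact: measurable_cst.
exact: (measurable_quadratic (measurable_RG rnd k)).
Qed.

(** The pointwise descent is averaged with the gradient term kept on the left, so that both sides
    are nonnegative. Finiteness of the expected excess makes the expected squared gradient a real
    number [gam], which can then be subtracted. *)
Lemma excess_step k : (\int[P]_w (F k w)%:E < +oo)%E ->
  (\int[P]_w (F k.+1 w)%:E <=
    (1 - mu / (24 * \tr A))%:E * \int[P]_w (F k w)%:E +
    (C1 * rho ^+ 2 + C2 * (delta ^+ 2 / rho ^+ 2))%:E)%E.
Proof.
move=> Foo.
have F0 j w : (0 <= (F j w)%:E)%E by rewrite lee_fin excess_ge0.
have mF j : measurable_fun setT (fun w => (F j w)%:E).
  exact/measurable_EFinP/measurable_excess.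
have [b gE] := grad_affine quad_f hess_f.
pose g w := grad f (x k w); pose G w := dot (g w) (g w).
have mgrad d' (U : measurableType d') (X : U -> 'cV[R]_d) :
    measurable_vec X -> measurable_vec (fun u => grad f (X u)).
  move=> mX; rewrite (_ : (fun u => _) = fun u => A *m X u + b); last first.
    by apply/funext => u; rewrite gE.
  exact/measurable_vecD/measurable_vec_cst/measurable_vec_mulmx.
have mg : measurable_vec g by exact: (mgrad _ _ _ (measurable_RG rnd k)).
have gxi : std_gaussian P (xi k) by have [] := rnd.
have mxi := gxi.1.
pose s w := dot (g w) (xi k w); pose q w := dot (xi k w) (A *m xi k w).
have q0 w : 0 <= q w by exact: (hessian_psd quad_f hess_f mu0 sc_f).
have ms : measurable_fun setT s by exact: (measurable_dot mg mxi).
have mq : measurable_fun setT q.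
  exact: (measurable_dot mxi (measurable_vec_mulmx A mxi)).
have mG : measurable_fun setT (fun w => (G w)%:E).
  exact/measurable_EFinP/(measurable_dot mg mg).
have G0 w : (0 <= (G w)%:E)%E by rewrite lee_fin dot_ge0.
have [M1 M2 M3 M4] := gaussian_quadratic_form_moments gxi
  (hessian_sym quad_f hess_f) (hessian_psd quad_f hess_f mu0 sc_f) trA.
have mPhi2 d' (U : measurableType d') (X Y : U -> 'cV[R]_d) :
    measurable_vec X -> measurable_vec Y -> measurable_fun setT
    (fun u => (dot (grad f (X u)) (Y u) ^+ 2)%:E).
  move=> mX mY; apply/measurable_EFinP/measurable_funX.
  exact: (measurable_dot (mgrad _ _ _ mX) mY).
have Phi20 (y z : 'cV[R]_d) : (0 <= (dot (grad f y) z ^+ 2)%:E)%E.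
  by rewrite lee_fin sqr_ge0.
have Is : (\int[P]_w (s w ^+ 2)%:E = \int[P]_w (G w)%:E)%E.
  rewrite (RG_tonelli rnd k mPhi2 Phi20); apply: eq_integral => w _.
  by have [] := gaussian_dot_moments gxi (grad f (RG h rho x0 fo xi k w)).
have mPhi d' (U : measurableType d') (X Y : U -> 'cV[R]_d) :
    measurable_vec X -> measurable_vec Y -> measurable_fun setT
    (fun u => (dot (grad f (X u)) (Y u) ^+ 2 * dot (Y u) (A *m Y u))%:E).
  move=> mX mY; apply/measurable_EFinP; apply: measurable_funM.
    by apply/measurable_funX; exact: (measurable_dot (mgrad _ _ _ mX) mY).
  exact: (measurable_dot mY (measurable_vec_mulmx A mY)).
have Phi0 y z : (0 <= (dot (grad f y) z ^+ 2 * dot z (A *m z))%:E)%E.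
  rewrite lee_fin mulr_ge0 ?sqr_ge0//.
  exact: (hessian_psd quad_f hess_f mu0 sc_f).
have Isq : (\int[P]_w (s w ^+ 2 * q w)%:E <=
    (3 * \tr A)%:E * \int[P]_w (G w)%:E)%E.
  rewrite (RG_tonelli rnd k mPhi Phi0).
  rewrite -ge0_integralZl//; last by rewrite lee_fin mulr_ge0// ltW.
  apply: ge0_le_integral => //.
  - by move=> w _; exact: integral_ge0.
  - exact: (measurable_RG_average rnd k mPhi Phi0).
  - by apply: emeasurable_funM => //; exact: measurable_cst.
pose r := fine (\int[P]_w (F k w)%:E)%E.
have rE : (\int[P]_w (F k w)%:E = r%:E)%E.
  by rewrite fineK// ge0_fin_numE// integral_ge0.
have IG_ub : (\int[P]_w (G w)%:E <= (2 * \tr A * r)%:E)%E.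
  rewrite EFinM -rE -ge0_integralZl//; last by rewrite lee_fin mulr_ge0// ltW.
  apply: ge0_le_integral => //.
  - by apply: emeasurable_funM => //; exact: measurable_cst.
  - move=> w _; rewrite -EFinM lee_fin.
    exact: (grad_upper_bound quad_f hess_f mu0 sc_f min_f).
pose gam := fine (\int[P]_w (G w)%:E)%E.
have gamE : (\int[P]_w (G w)%:E = gam%:E)%E.
  by rewrite fineK// ge0_fin_numE ?integral_ge0// (le_lt_trans IG_ub)// ltry.
have gam_lb : 2 * mu * r <= gam.
  rewrite -lee_fin -gamE EFinM -rE -ge0_integralZl//; last first.
    by rewrite lee_fin mulr_ge0// ltW.
  apply: ge0_le_integral => //.
  - by move=> w _; rewrite mule_ge0// lee_fin mulr_ge0// ltW.
  - by apply: emeasurable_funM => //; exact: measurable_cst.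
  - by move=> w _; rewrite -EFinM lee_fin; exact: polyak_lojasiewicz.
pose K := 16 / 3 * (delta ^+ 2 / rho ^+ 2).
pose h0 := h 0.
have h0_ge0 : 0 <= h0 by apply: divr_ge0 => //; apply: mulr_ge0 => //; exact: ltW.
have K0 : 0 <= K by rewrite mulr_ge0// divr_ge0 ?sqr_ge0.
pose a1 := h0 ^+ 2; pose a2 := rho ^+ 2 * h0 / 2.
pose a3 := rho ^+ 2 * h0 ^+ 2; pose a4 := K * h0 / 2; pose a5 := K * h0 ^+ 2.
have a10 : 0 <= a1 by exact: sqr_ge0.
have a20 : 0 <= a2 by rewrite divr_ge0// mulr_ge0// sqr_ge0.
have a30 : 0 <= a3 by rewrite mulr_ge0 ?sqr_ge0.
have a40 : 0 <= a4 by rewrite divr_ge0// mulr_ge0.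
have a50 : 0 <= a5 by rewrite mulr_ge0 ?sqr_ge0.
have step w : F k.+1 w + h0 / 2 * s w ^+ 2 <=
    F k w + a1 * (s w ^+ 2 * q w) + a2 * q w ^+ 2 + a3 * q w ^+ 3 + a4 + a5 * q w.
  have := random_step_descent quad_f hess_f mu0 sc_f (x k w) (xi k w)
    rho0 h0_ge0 (@of_f k w).
  rewrite -/(x k.+1 w) /F -/(s w) -/(q w) /a1 /a2 /a3 /a4 /a5 /K.
  by rewrite /x /= -/x => H; lra.
have addI (u v : T -> R) c : measurable_fun setT u -> measurable_fun setT v ->
    (forall w, 0 <= u w) -> (forall w, 0 <= v w) -> 0 <= c ->
    (\int[P]_w (u w + c * v w)%:E =
     \int[P]_w (u w)%:E + c%:E * \int[P]_w (v w)%:E)%E /\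
    measurable_fun setT (fun w => u w + c * v w) /\
    (forall w, 0 <= u w + c * v w).
  move=> mu' mv u0 v0 c0; split; last split.
  - under eq_integral do rewrite EFinD EFinM.
    have mvE : measurable_fun setT (fun w => (v w)%:E) by exact/measurable_EFinP.
    rewrite ge0_integralD//.
    + by rewrite ge0_integralZl// => w _; rewrite lee_fin.
    + by move=> w _; rewrite lee_fin.
    + exact/measurable_EFinP.
    + by move=> w _; rewrite -EFinM lee_fin mulr_ge0.
    + by apply: emeasurable_funM => //; exact: measurable_cst.
  - apply: measurable_funD => //; apply: measurable_funM => //; exact: measurable_cst.
  - by move=> w; rewrite addr_ge0// mulr_ge0.
have ms2 : measurable_fun setT (fun w => s w ^+ 2) by exact: measurable_funX.
have s20 w : 0 <= s w ^+ 2 by exact: sqr_ge0.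
have msq : measurable_fun setT (fun w => s w ^+ 2 * q w) by exact: measurable_funM.
have sq0 w : 0 <= s w ^+ 2 * q w by exact: mulr_ge0.
have mqn n : measurable_fun setT (fun w => q w ^+ n) by exact: measurable_funX.
have qn0 n w : 0 <= q w ^+ n by exact: exprn_ge0.
have m1 : measurable_fun setT (fun _ : T => 1 : R) by exact: measurable_cst.
have h20 : 0 <= h0 / 2 by exact: divr_ge0.
have [L1 [mL L0]] := addI _ _ _ (measurable_excess k.+1) ms2 (excess_ge0 k.+1) s20 h20.
have [R1 [mR1 R10]] := addI _ _ _ (measurable_excess k) msq (excess_ge0 k) sq0 a10.
have [R2 [mR2 R20]] := addI _ _ _ mR1 (mqn 2) R10 (qn0 2) a20.
have [R3 [mR3 R30]] := addI _ _ _ mR2 (mqn 3) R20 (qn0 3) a30.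
(* The constant term enters as [a4] times the function 1, so that [addI] covers it. *)
have [R4 [mR4 R40]] := addI _ _ _ mR3 m1 R30 (fun=> ler01) a40.
have [R5 [mR5 R50]] := addI _ _ _ mR4 mq R40 q0 a50.
have : (\int[P]_w (F k.+1 w + h0 / 2 * s w ^+ 2)%:E <= \int[P]_w
    (F k w + a1 * (s w ^+ 2 * q w) + a2 * q w ^+ 2 + a3 * q w ^+ 3 + a4 * 1
     + a5 * q w)%:E)%E.
  apply: ge0_le_integral => //.
  - by move=> w _; rewrite lee_fin.
  - exact/measurable_EFinP.
  - exact/measurable_EFinP.
  - by move=> w _; rewrite lee_fin mulr1.
rewrite L1 R5 R4 R3 R2 R1 Is M1 gamE rE integral_cst//= probability_setT mule1.
rewrite gamE in Isq => main.
have {}main : (\int[P]_w (F k.+1 w)%:E + (h0 / 2 * gam)%:E <=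
    (r + a1 * (3 * \tr A * gam) + a2 * (3 * \tr A ^+ 2)
     + a3 * (15 * \tr A ^+ 3) + a4 * 1 + a5 * \tr A)%:E)%E.
  apply: le_trans main _; rewrite !EFinD !(EFinM a1, EFinM a2, EFinM a3).
  rewrite (EFinM a4) (EFinM a5).
  by rewrite !leeD// lee_wpmul2l.
rewrite -leeBrDr// -EFinB in main.
apply: le_trans main _; rewrite -EFinM -EFinD lee_fin.
rewrite /a1 /a2 /a3 /a4 /a5 /h0 /h /K /C1 /C2.
set D := delta ^+ 2 / rho ^+ 2.
have D0 : 0 <= D by rewrite divr_ge0 ?sqr_ge0.
have dge1 : (1 : R) <= d%:R by rewrite ler1n.
have t_neq0 : \tr A != 0 by rewrite gt_eqF.
(* Three nonnegative slacks. The gain [h0 / 2] less the cost [3 \tr A h0^2] leaves [1 / (48 \tr A)]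
   in front of [gam], which the Polyak-Lojasiewicz bound turns into the rate [mu / (24 \tr A)]. The
   noise costs are [(1/8 + 5/48) \tr A rho^2] and [(2/9 + 1/27) D / \tr A], below the [C1] and [C2]
   terms because [d >= 1]. *)
rewrite -subr_ge0 (_ : _ - _ = (gam - 2 * mu * r) / (48 * \tr A)
  + (5 / 16 * (d%:R - 1) + 37 / 384) * \tr A * rho ^+ 2
  + ((d%:R - 1) / 3 + 19 / 216) / \tr A * D); last by field.
have dm0 : 0 <= d%:R - 1 :> R by rewrite subr_ge0.
have tr0 := ltW trA.
apply: addr_ge0; first apply: addr_ge0.
- by rewrite divr_ge0 ?subr_ge0// mulr_ge0.
- apply: mulr_ge0; last exact: sqr_ge0.
  by apply: mulr_ge0 => //; lra.
- by apply: mulr_ge0 => //; apply: divr_ge0 => //; lra.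
Qed.

(** The start is deterministic, and [excess_step] propagates finiteness. *)
Lemma excess_integrable k : (\int[P]_w (F k w)%:E < +oo)%E.
Proof.
elim: k => [|k IH].
  rewrite /F /x /= integral_cst//= probability_setT mule1; exact: ltry.
apply: le_lt_trans (excess_step IH) _.
have -> : (\int[P]_w (F k w)%:E = (fine (\int[P]_w (F k w)%:E))%:E)%E.
  rewrite fineK// ge0_fin_numE// integral_ge0// => w _.
  by rewrite lee_fin excess_ge0.
by rewrite -EFinM -EFinD ltry.
Qed.

(** [f] itself may change sign, so integrability of the nonnegative excess is what allows the
    constant [fstar] to be split off. *)
Lemma expectation_iterate k :
  ('E_P[fun w => f (x k w)] - fstar%:E = \int[P]_w (F k w)%:E)%E.
Proof.
have mF : measurable_fun setT (fun w => (F k w)%:E).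
  exact/measurable_EFinP/measurable_excess.
have F0 w : (0 <= (F k w)%:E)%E by rewrite lee_fin excess_ge0.
have iF : P.-integrable setT (fun w => (F k w)%:E).
  apply/integrableP; split => //.
  under eq_integral do rewrite gee0_abs//.
  exact: excess_integrable.
rewrite unlock; under eq_integral do rewrite -[f _](subrK fstar) EFinD.
rewrite integralD//; last exact: finite_measure_integrable_cst.
by rewrite integral_cst//= probability_setT mule1 addeK.
Qed.

End one_step.

Theorem theorem1 (R : realType) (disp : measure_display)
    (T : measurableType disp) (P : probability T R) (d : nat)
    (f : 'cV[R]_d -> R) (A : 'M[R]_d) (mu L fstar rho delta : R)
    (x0 : 'cV[R]_d) (fo : nat -> T -> 'cV[R]_d -> R)
    (xi : nat -> T -> 'cV[R]_d) :
  quadratic f ->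
  (forall x, hessian f x = A) ->
  0 < mu -> strongly_convex mu f ->
  lipschitz_gradient L f ->
  is_minimum f fstar ->
  0 < rho -> 0 <= delta ->
  (forall k w, approx_oracle delta f (fo k w)) ->
  let h := fun _ : nat => 1 / (12 * \tr A) in
  RG_randomness h rho x0 fo xi P ->
  let x := RG h rho x0 fo xi in
  let C1 := 5 / 16 * \tr A * d%:R + 5 / 384 * \tr A in
  let C2 := d%:R / (3 * \tr A) + 1 / (72 * \tr A) in
  let err := 24 * \tr A / mu *
               (C1 * rho ^+ 2 + C2 * (delta ^+ 2 / rho ^+ 2)) in
  forall k : nat,
    ('E_P[fun w => f (x k.+1 w)] - fstar%:E - err%:E <=
     (1 - mu / (24 * \tr A))%:E *
       ('E_P[fun w => f (x k w)] - fstar%:E - err%:E))%E.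
Proof.
move=> quad_f hess_f mu0 sc_f _ min_f rho0 _ of_f h rnd x C1 C2 err k.
(* In dimension 0 the trace vanishes and division by it gives 0 by convention; [f] is the constant
   [fstar] and [err] is 0, so both sides are 0. *)
case: (posnP d) => [d0|d0].
  have noI (i : 'I_d) : False by case: i => i; rewrite d0.
  have tr0 : \tr A = 0 by apply: big1 => i; case: (noI i).
  have fE y : f y = fstar.
    have [[z <-] _] := min_f; by congr f; apply/matrixP => i; case: (noI i).
  have EE j : ('E_P[fun w => f (x j w)] = fstar%:E)%E.
    rewrite unlock; under eq_integral do rewrite fE.
    by rewrite integral_cst//= probability_setT mule1.
  by rewrite !EE /err tr0 !(mulr0, mul0r, invr0, subr0) mul1e.
have Foo := excess_integrable quad_f hess_f mu0 sc_f min_f rho0 d0 of_f rnd k.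
have := excess_step quad_f hess_f mu0 sc_f min_f rho0 d0 of_f rnd Foo.
rewrite !(expectation_iterate quad_f hess_f mu0 sc_f min_f rho0 d0 of_f rnd).
set E1 := (\int[P]_w _)%E; set E0 := (\int[P]_w _)%E in Foo * => step.
have E00 : (0 <= E0)%E.
  by apply: integral_ge0 => w _; rewrite lee_fin subr_ge0; exact: min_f.2.
have E0_fin : E0 \is a fin_num by rewrite ge0_fin_numE.
move: step; rewrite -/C1 -/C2 -(fineK E0_fin) -EFinB -!EFinM -EFinD => step.
rewrite leeBlDr// -EFinD; apply: le_trans step _.
(* [err] is the fixed point of the one-step bound: [mu / (24 \tr A) * err] equals the additive noise
   term, so this comparison is an equality. *)
rewrite lee_fin le_eqVlt; apply/orP; left; apply/eqP.
have t_neq0 : \tr A != 0.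
  by rewrite gt_eqF// (hessian_trace_gt0 quad_f hess_f mu0 sc_f).
have mu_neq0 : mu != 0 by rewrite gt_eqF.
rewrite /err; move: (C1 * _ + _) (fine _) => c e.
by field; rewrite t_neq0 mu_neq0.
Qed.
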